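(* Let $q$ be a power of an odd prime and $E,F\subset\mathbb F_q^d$. (1) If $d\geq 2$ is even and $|E||F|\geq 16q^d$, then $$ |\Delta(E,F)|\geq \begin{cases} \frac{q}{144} &\text{if } 1\le |E|< q^{\frac{d-1}{2}},\\[2pt] \frac{1}{144} \min\left\{ q, \frac{|F|}{ 2q^{\frac{d-1}{2}}}\right\} &\text{if } q^{\frac{d-1}{2}}\leq |E|< q^{\frac{d+1}{2}},\\[2pt] \frac{1}{144} \min\left\{ q, \frac{2|E||F|}{q^d}\right\} &\text{if } q^{\frac{d+1}{2}}\leq |E|\leq q^{d}.\end{cases}$$ (2) If $d=2$ and $|E||F|\geq 16q^2$, then $$|\Delta(E,F)|\geq \frac{1}{72}\min\left\{\frac{q}{2},\ \frac{|E|^{1/2}|F|}{\sqrt3\, q}\right\}.$$ (3) If $d=2$, $E,F$ are nonempty, and $-1$ is not a square in $\mathbb F_q$ (no hypothesis on $|E||F|$), then $$|\Delta(E,F)|\geq \min\left\{\frac{q}{2},\ \frac{|E|^{1/2}|F|}{2(\sqrt3+1)q}\right\}.$$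
   Context: $\mathbb F_q$ is the finite field with $q$ elements, of characteristic greater than two. For $m=(m_1,\dots,m_d)\in\mathbb F_q^d$ put $\|m\|=m_1^2+\dots+m_d^2\in\mathbb F_q$. For $E,F\subset\mathbb F_q^d$ the distance set is $\Delta(E,F)=\{\|x-y\|\in\mathbb F_q: x\in E,\ y\in F\}$. *)

(* Defs.v *)
From HB Require Import structures.
From mathcomp Require Import all_boot all_order all_algebra all_field.
Set Implicit Arguments. Unset Strict Implicit. Unset Printing Implicit Defensive.
Import Order.TTheory GRing.Theory Num.Theory.
Local Open Scope ring_scope.

Definition sqnorm (K : finFieldType) (d : nat) (m : 'rV[K]_d) : K :=
  \sum_(i < d) (m 0 i) ^+ 2.

Definition dist_set (K : finFieldType) (d : nat) (E G : {set 'rV[K]_d}) : {set K} :=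
  [set sqnorm (x - y) | x in E, y in G].

(* Main.v *)
Require Import Defs.
From HB Require Import structures.
From mathcomp Require Import all_boot all_order all_algebra all_field.
From mathcomp Require Import complex zify ring lra.
Set Implicit Arguments. Unset Strict Implicit. Unset Printing Implicit Defensive.
Import Order.TTheory GRing.Theory Num.Theory Normc.
Local Open Scope ring_scope.

(** All bounds come from the second moment of the number [nu t] of pairs in [E * G]
    at distance [t]: if [D] distances occur, then by Cauchy-Schwarz
    [(\sum_t nu t)^2 <= D * \sum_t (nu t)^2].  The Gauss sum identity for
    [psi (s * sqnorm z)] turns the exponential sums
    [\sum_t nu t * psi (s * t)] into sums over spheres in frequency space, so the
    second moment is governed by the mass [M_r] of the Fourier transform of [E] on
    the spheres of radius [r != 0].  In even dimension the zero radius only disturbs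
    [nu 0], which the hypothesis [16 q^d <= e f] keeps below [2/3 e f].

    The mass [M_r] is bounded in two ways.  In the plane, a fourth-moment
    argument uses that two circles of the same nonzero radius meet in at most
    two points.  In even dimension the Fourier transform of a sphere is a
    Kloosterman sum [Kl], and [|Kl| <= 3 sqrt q] is needed.  For this, the
    [L]-function of the Kloosterman sum is [1 + Kl T + q T^2], so the
    Kloosterman sums [S_n] over the extensions of degree [n] satisfy
    [S_(n+2) + Kl S_(n+1) + q S_n = 0] and would grow at least like
    [(2 sqrt q)^n] if [|Kl| > 3 sqrt q]; Stepanov's polynomial method shows
    [|S_n| = O(q^(n/2))] for odd [n], the implied constant depending on [q]. *)

(** * Stepanov's method *)

Lemma exists_homogeneous_solution (F : fieldType) (I J : finType) (a : I -> J -> F) :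
  (#|J| < #|I|)%N ->
  exists2 c : I -> F, (exists i, c i != 0) & forall j, \sum_i c i * a i j = 0.
Proof.
move=> ltJI; pose A := \matrix_(i < #|I|, j < #|J|) a (enum_val i) (enum_val j).
have : kermx A != 0.
  rewrite kermx_eq0 /row_free; apply: contraTneq ltJI => <-.
  by rewrite -leqNgt rank_leq_col.
case/rowV0Pn=> v /sub_kermxP vA0 /rV0Pn[k vk].
exists (fun i => v 0 (enum_rank i)); first by exists (enum_val k); rewrite enum_valK.
move=> j; have := congr1 (fun B : 'rV_#|J| => B 0 (enum_rank j)) vA0.
rewrite !mxE => rel; rewrite -[RHS]rel (reindex (@enum_val I I)) /=; last first.
  by apply: onW_bij; apply: enum_val_bij.
by apply: eq_bigr => i _; rewrite mxE enum_valK enum_rankK.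
Qed.

Lemma dvdp_XsubC_exp_nderivn (F : fieldType) (p : {poly F}) (x : F) (n : nat) :
  (forall i, (i < n)%N -> p^`N(i).[x] = 0) -> ('X - x%:P) ^+ n %| p.
Proof.
move=> p0; have taylor : p = \sum_(i < size (p^:P))
    p^:P^`N(i).[x%:P] * ('X - x%:P) ^+ i.
  rewrite -(nderiv_taylor p^:P (mulrC _ _)) addrC subrK.
  exact/esym/comp_polyXr.
rewrite taylor; apply: (big_ind (dvdp _)) => [|u v|i _]; first exact: dvdp0.
  exact: dvdp_add.
rewrite nderivn_map horner_map /=; have [/p0->|le_ni] := ltnP i n.
  by rewrite mul0r dvdp0.
by rewrite dvdp_mull // dvdp_exp2l.
Qed.

Lemma max_poly_multiple_roots (F : fieldType) (p : {poly F}) (s : seq F) (n : nat) :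
    p != 0 -> uniq s -> {in s, forall x, ('X - x%:P) ^+ n %| p} ->
  (size s * n < size p)%N.
Proof.
move=> p0 uniq_s dvd_s.
have : \prod_(x <- s) ('X - x%:P) ^+ n %| p.
  elim: s uniq_s dvd_s => [|x s IHs] /=; first by rewrite big_nil dvd1p.
  case/andP=> xs uniq_s dvd_s; rewrite big_cons Gauss_dvdp.
    by rewrite dvd_s ?mem_head // IHs // => y ys; apply: dvd_s; rewrite inE ys orbT.
  apply: coprimep_expl; rewrite prodrXl; apply: coprimep_expr.
  by rewrite coprimep_sym coprimep_XsubC root_prod_XsubC.
move/(dvdp_leq p0); rewrite prodrXl => /(leq_trans _)-> //.
rewrite -[X in (_ < X)%N]prednK ?size_exp ?size_prod_XsubC //.
by rewrite lt0n size_poly_eq0 expf_neq0 // monic_neq0 // monic_prod_XsubC.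
Qed.

Lemma sum_distinct_size_neq0 (R : nzRingType) (I : finType) (p : I -> {poly R}) :
    {in [pred i | p i != 0] &, injective (fun i => size (p i))} ->
  (exists i, p i != 0) -> \sum_i p i != 0.
Proof.
move=> size_inj [i0 pi0].
have [k pk max_k] := @arg_maxnP _ i0 (fun i => p i != 0) (fun i => size (p i)) pi0.
rewrite (bigD1 k) //= -size_poly_eq0 size_polyDl ?size_poly_eq0 //.
apply: leq_ltn_trans (size_sum _ _ _) _.
rewrite -(prednK (n := size (p k))) ?lt0n ?size_poly_eq0 // ltnS.
apply/bigmax_leqP => i ik; have [->|pi] := eqVneq (p i) 0; first by rewrite size_poly0.
rewrite -ltnS prednK ?lt0n ?size_poly_eq0 // ltn_neqAle [(_ <= _)%N]max_k // andbT.
by apply: contraNneq ik => /size_inj->.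
Qed.

Section Stepanov.
Variables (F : fieldType) (I : finType) (v w : I -> {poly F}) (deg : I -> nat).
Variables (M A B N : nat).
Hypotheses (M_gt0 : (0 < M)%N) (pcharM : [pchar F].-nat M).
Hypotheses (size_w : forall i, (size (w i) <= B)%N).
Hypothesis more_unknowns : (M * (A + B) < A * #|I|)%N.
Hypotheses (v_neq0 : forall i, v i != 0) (deg_inj : injective deg).
Hypothesis deg_v : forall i, (M * (size (v i)).-1 = A * deg i)%N.
Hypothesis deg_lt : forall i, (deg i < N)%N.

Lemma exists_auxiliary_coefs : exists r : I -> {poly F},
  [/\ forall i, (size (r i) <= A)%N, exists i, r i != 0 &
      forall l, (l < M)%N -> \sum_i (r i)^`N(l) * w i = 0].
Proof.
pose a (u : 'I_A * I) (e : 'I_M * 'I_(A + B)) : F := (('X^(u.1))^`N(e.1) * w u.2)`_e.2.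
have lt_card : (#|{: 'I_M * 'I_(A + B)}| < #|{: 'I_A * I}|)%N.
  by rewrite !card_prod !card_ord.
have [c [[k0 i0] /= c0] rel] := exists_homogeneous_solution a lt_card.
pose r i : {poly F} := \sum_(k < A) c (k, i) *: 'X^k.
exists r; split=> [i||l lM].
- apply: leq_trans (size_sum _ _ _) _; apply/bigmax_leqP => k _.
  by apply: leq_trans (size_scale_leq _ _) _; rewrite size_polyXn.
- exists i0; apply: contraNneq c0 => r0.
  have := congr1 (fun p : {poly F} => p`_k0) r0.
  rewrite coef0 coef_sumMXn (big_pred1 k0) => [->//|k].
  exact: val_eqE.
have rE i : (r i)^`N(l) * w i = \sum_(k < A) c (k, i) *: (('X^k)^`N(l) * w i).
  rewrite /r linear_sum mulr_suml; apply: eq_bigr => k _.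
  by rewrite linearZ /= scalerAl.
under eq_bigr do rewrite rE.
rewrite exchange_big pair_big /=; apply/polyP => n; rewrite coef_sum coef0.
have [ltn|len] := ltnP n (A + B).
  rewrite -[RHS](rel (Ordinal lM, Ordinal ltn)).
  by apply: eq_bigr => -[k i] _; rewrite coefZ.
rewrite big1 // => -[k i] _; rewrite coefZ [X in _ * X]nth_default ?mulr0 //=.
apply: leq_trans (size_polyMleq _ _) _; apply: leq_trans (leq_pred _) _.
apply: leq_trans len; apply: leq_add (size_w i).
rewrite nderivnXn -scaler_nat; apply: leq_trans (size_scale_leq _ _) _.
by rewrite size_polyXn; apply: leq_ltn_trans (leq_subr _ _) (ltn_ord k).
Qed.

Lemma size_mul_comp_Xn (r : {poly F}) i : r != 0 ->
  size (r * (v i \Po 'X^M)) = (A * deg i + size r)%N.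
Proof.
move=> r0; have v0 : v i \Po 'X^M != 0.
  by rewrite comp_poly_eq0 // size_polyXn ltnS.
have size_comp : size (v i \Po 'X^M) = (A * deg i).+1.
  rewrite -[LHS]prednK ?lt0n ?size_poly_eq0 //.
  by rewrite size_comp_poly size_polyXn /= mulnC deg_v.
by rewrite size_mul // size_comp addnS addnC.
Qed.

Lemma auxiliary_poly_neq0 (r : I -> {poly F}) :
    (forall i, (size (r i) <= A)%N) -> (exists i, r i != 0) ->
  \sum_i r i * (v i \Po 'X^M) != 0.
Proof.
move=> size_r [i0 ri0]; have nz i : (r i * (v i \Po 'X^M) != 0) = (r i != 0).
  by rewrite mulf_eq0 negb_or comp_poly_eq0 ?size_polyXn ?ltnS // v_neq0 andbT.
apply: sum_distinct_size_neq0; last by exists i0; rewrite nz.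
move=> i j; rewrite !inE !nz => ri rj; rewrite !size_mul_comp_Xn // => sizeE.
have block k l : (size (r k) + A * deg k = size (r l) + A * deg l)%N ->
    r k != 0 -> (deg k <= deg l)%N.
  move=> E; rewrite -size_poly_eq0 -lt0n => rk; rewrite -ltnS.
  have A_gt0 : (0 < A)%N := leq_trans rk (size_r k).
  rewrite -(ltn_pmul2l A_gt0) mulnS; have := size_r l; lia.
by apply/deg_inj/eqP; rewrite eqn_leq !block // ![(size _ + _)%N]addnC.
Qed.

Lemma size_auxiliary_poly (r : I -> {poly F}) : (forall i, (size (r i) <= A)%N) ->
  (size (\sum_i r i * (v i \Po 'X^M))%R <= A * N)%N.
Proof.
move=> size_r; apply: leq_trans (size_sum _ _ _) _; apply/bigmax_leqP => i _.
have [->|ri] := eqVneq (r i) 0; first by rewrite mul0r size_poly0.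
rewrite size_mul_comp_Xn //; apply: (@leq_trans (A * (deg i).+1)).
  by rewrite mulnS addnC leq_add2r.
by rewrite leq_mul2l deg_lt orbT.
Qed.

(* Modulo ['X^M - x^M = ('X - x)^M] each [v i (X^M)] is the constant
   [v i (x^M) = c * w i (x)]. *)
Lemma dvdp_auxiliary_poly (r : I -> {poly F}) (x c : F) :
    (forall l, (l < M)%N -> \sum_i (r i)^`N(l) * w i = 0) ->
    (forall i, (v i).[x ^+ M] = c * (w i).[x]) ->
  ('X - x%:P) ^+ M %| \sum_i r i * (v i \Po 'X^M).
Proof.
move=> rel vE; set D := ('X - x%:P) ^+ M.
have DE : D = 'X^M - (x ^+ M)%:P.
  have pM : [pchar {poly F}].-nat M by rewrite (eq_pnat _ (pchar_poly F)).
  by rewrite /D exprDn_pchar // exprNn_pchar // -polyC_exp.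
have reduce i : D %| r i * (v i \Po 'X^M) - (v i).[x ^+ M] *: r i.
  have /factor_theorem[h vh] : root (v i - (v i).[x ^+ M]%:P) (x ^+ M).
    by rewrite rootE !hornerE subrr.
  rewrite -mul_polyC [_%:P * _]mulrC -mulrBr -(comp_polyC _ 'X^M) -comp_polyB vh.
  by rewrite comp_polyM comp_polyB comp_polyX comp_polyC -DE mulrA dvdp_mull.
have -> : \sum_i r i * (v i \Po 'X^M) = \sum_i (v i).[x ^+ M] *: r i +
    \sum_i (r i * (v i \Po 'X^M) - (v i).[x ^+ M] *: r i).
  by rewrite -big_split; apply: eq_bigr => i _; rewrite [RHS]addrC subrK.
apply: dvdp_add; last first.
  by apply: (big_ind (dvdp D)) => [|p q|i _]; rewrite ?dvdp0 //; apply: dvdp_add.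
apply: dvdp_XsubC_exp_nderivn => l lM; rewrite linear_sum horner_sum.
have := congr1 (horner^~ x) (rel l lM); rewrite horner_sum horner0 => rel_x.
rewrite -[RHS](mulr0 c) -[X in c * X]rel_x mulr_sumr; apply: eq_bigr => i _.
by rewrite linearZ hornerZ vE (hornerM (_^`N(l))) -mulrA [_.[x] * _]mulrC.
Qed.

Lemma stepanov (s : seq F) : uniq s ->
    {in s, forall x, exists c, forall i, (v i).[x ^+ M] = c * (w i).[x]} ->
  (size s * M < A * N)%N.
Proof.
move=> uniq_s sol_s; have [r [size_r r_neq0 rel]] := exists_auxiliary_coefs.
apply: leq_trans (size_auxiliary_poly size_r).
apply: max_poly_multiple_roots => // [|x /sol_s[c vE]].
  exact: auxiliary_poly_neq0.
exact: dvdp_auxiliary_poly vE.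
Qed.

End Stepanov.

Section FrobeniusSum.
Variables (F : fieldType) (q : nat) (a b : F).

Definition frobenius_sum (k : nat) (x : F) : F :=
  \sum_(i < k) (a * x ^+ (q ^ i) + b * x^-1 ^+ (q ^ i)).

(* [frobenius_sum k] with denominators cleared by ['X^N]. *)
Definition frobenius_poly (k N : nat) : {poly F} :=
  \sum_(i < k) (a *: 'X^(N + q ^ i) + b *: 'X^(N - q ^ i)).

Lemma frobenius_sumD k l x :
  frobenius_sum (k + l) x = frobenius_sum k x + frobenius_sum l (x ^+ (q ^ k)).
Proof.
rewrite /frobenius_sum big_split_ord /=; congr (_ + _).
by apply: eq_bigr => i _; rewrite -exprVn -!exprM expnD.
Qed.

Lemma horner_frobenius_poly k N x : x != 0 -> (forall i : 'I_k, q ^ i <= N)%N ->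
  (frobenius_poly k N).[x] = x ^+ N * frobenius_sum k x.
Proof.
move=> x0 leN; rewrite /frobenius_poly /frobenius_sum horner_sum mulr_sumr.
apply: eq_bigr => i _; rewrite !hornerE mulrDr exprD mulrCA; congr (_ + _).
have -> : x ^+ N = x ^+ (N - q ^ i) * x ^+ (q ^ i) by rewrite -exprD subnK.
by rewrite [RHS]mulrCA exprVn -mulrA mulfV ?mulr1 // expf_neq0.
Qed.

Lemma size_frobenius_poly_leq k N : (forall i : 'I_k, q ^ i <= N)%N ->
  (size (frobenius_poly k N) <= (2 * N).+1)%N.
Proof.
move=> leN; apply: leq_trans (size_sum _ _ _) _; apply/bigmax_leqP => i _.
apply: leq_trans (size_polyD _ _) _.
by rewrite geq_max !(leq_trans (size_scale_leq _ _)) // size_polyXn; have := leN i; lia.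
Qed.

Lemma size_frobenius_poly k : (1 < q)%N -> a != 0 ->
  size (frobenius_poly k.+1 (q ^ k)) = (2 * q ^ k).+1.
Proof.
move=> q_gt1 a0; rewrite /frobenius_poly big_ord_recr /= addrCA.
have size_top : size (a *: 'X^(q ^ k + q ^ k)) = (2 * q ^ k).+1.
  by rewrite size_scale // size_polyXn; lia.
have qk_gt0 : (0 < q ^ k)%N by rewrite expn_gt0 ltnW.
rewrite size_polyDl size_top // ltnS; apply: leq_trans (size_polyD _ _) _.
rewrite geq_max; apply/andP; split; last first.
  by apply: leq_trans (size_scale_leq _ _) _; rewrite size_polyXn; lia.
apply: leq_trans (size_sum _ _ _) _; apply/bigmax_leqP => i _.
have lt_qi : (q ^ i < q ^ k)%N by rewrite ltn_exp2l.
apply: leq_trans (size_polyD _ _) _.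
by rewrite geq_max !(leq_trans (size_scale_leq _ _)) // size_polyXn; lia.
Qed.

End FrobeniusSum.

Section HomogeneousFactor.
Variables (F : fieldType) (q : nat).
Implicit Types (p : {poly F}) (N i e : nat) (y t : F).

(* If [p] has degree [2 * N] and [p.[y] = y ^+ N * t], the power of ['X] is chosen
   so that the exponent of [y] in the value at [y] does not depend on [i]. *)
Definition homogeneous_factor (p : {poly F}) (N i e : nat) : {poly F} :=
  p ^+ i * 'X^(N * (q.-1 - i) + e).

Lemma horner_homogeneous_factor p N i e y t : (i <= q.-1)%N -> p.[y] = y ^+ N * t ->
  (homogeneous_factor p N i e).[y] = y ^+ (N * q.-1) * (t ^+ i * y ^+ e).
Proof.
move=> iq py; rewrite /homogeneous_factor hornerM horner_exp hornerXn py exprMn.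
have -> : y ^+ (N * q.-1) = (y ^+ N) ^+ i * y ^+ (N * (q.-1 - i)).
  by rewrite -exprM -exprD -mulnDr subnKC.
by rewrite exprD; ring.
Qed.

Lemma size_homogeneous_factor_leq p N i e : (i <= q.-1)%N -> (size p <= (2 * N).+1)%N ->
  (size (homogeneous_factor p N i e) <= (N * (q.-1 + i) + e).+1)%N.
Proof.
move=> iq size_p; apply: leq_trans (size_polyMleq _ _) _.
have size_pi : (size (p ^+ i) <= (2 * N * i).+1)%N.
  apply: leq_trans (size_poly_exp_leq _ _) _; rewrite ltnS leq_mul2r.
  by apply/orP; right; lia.
rewrite size_polyXn addnS /=; apply: leq_trans (leq_add size_pi (leqnn _)) _.
have : (N * i + N * (q.-1 - i) = N * q.-1)%N by rewrite -mulnDr subnKC.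
rewrite mulnDr -mulnA; move: (N * (q.-1 - i))%N (N * q.-1)%N (N * i)%N; lia.
Qed.

Lemma size_homogeneous_factor p N i e : (i <= q.-1)%N -> size p = (2 * N).+1 ->
  size (homogeneous_factor p N i e) = (N * (q.-1 + i) + e).+1.
Proof.
move=> iq size_p; have p0 : p != 0 by rewrite -size_poly_eq0 size_p.
rewrite size_mulXn ?expf_neq0 //.
rewrite -(prednK (n := size (p ^+ i))) ?lt0n ?size_poly_eq0 ?expf_neq0 //.
rewrite size_exp size_p /=.
have : (N * i + N * (q.-1 - i) = N * q.-1)%N by rewrite -mulnDr subnKC.
rewrite mulnDr -mulnA; move: (N * (q.-1 - i))%N (N * q.-1)%N (N * i)%N; lia.
Qed.

End HomogeneousFactor.

Section FrobeniusSumFiber.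
Variables (F : fieldType) (q mu : nat) (a b c : F).
Hypotheses (q_gt2 : (2 < q)%N) (pcharq : [pchar F].-nat q) (a_neq0 : a != 0).

Let m := (q ^ mu)%N.
Let M := (q ^ mu.+1)%N.
Let q_gt0 : (0 < q)%N. Proof. exact: ltn_trans q_gt2. Qed.
Let m_gt0 : (0 < m)%N. Proof. by rewrite expn_gt0 q_gt0. Qed.
Let ME : M = (q * m)%N. Proof. exact: expnS. Qed.

Let low := c *: 'X^m - frobenius_poly q a b mu.+1 m.
Let high := frobenius_poly q a b mu.+2 M.
Let low_factor (ij : 'I_q * 'I_m.+1) := homogeneous_factor q low m ij.1 ij.2.
Let high_factor (ij : 'I_q * 'I_m.+1) :=
  homogeneous_factor q high M ij.1 (q * M * ij.2).
Let deg (ij : 'I_q * 'I_m.+1) : nat := (q.-1 + (ij.1 + q * ij.2))%N.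

Let ord_le_pred (i : 'I_q) : (i <= q.-1)%N.
Proof. by rewrite -ltnS prednK. Qed.

Let expn_ord_le k (i : 'I_k.+1) : (q ^ i <= q ^ k)%N.
Proof. by rewrite leq_exp2l ?(ltnW q_gt2) // -ltnS. Qed.

Let frobenius_sum_solution x := [/\ x != 0, x ^+ (q ^ (mu.+1 + mu.+2)) = x &
  frobenius_sum q a b (mu.+1 + mu.+2) x = c].

(* The sum splits as [c = frobenius_sum mu.+1 x + frobenius_sum mu.+2 (x ^+ M)],
   so [low] at [x] and [high] at [x ^+ M] take the same value up to powers of [x]. *)
Let horner_high_factor x : frobenius_sum_solution x ->
  exists d, forall ij, (high_factor ij).[x ^+ M] = d * (low_factor ij).[x].
Proof.
case=> x0 xQ sum_x; pose t := frobenius_sum q a b mu.+2 (x ^+ M).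
have low_x : low.[x] = x ^+ m * t.
  rewrite !hornerE (horner_frobenius_poly _ _ x0 (@expn_ord_le mu)).
  by rewrite -sum_x frobenius_sumD -/M -/t; ring.
have high_x : high.[x ^+ M] = (x ^+ M) ^+ M * t.
  by rewrite (horner_frobenius_poly _ _ _ (@expn_ord_le mu.+1)) ?expf_neq0.
exists ((x ^+ M) ^+ (M * q.-1) / x ^+ (m * q.-1)) => ij.
rewrite (horner_homogeneous_factor _ (ord_le_pred _) high_x).
rewrite (horner_homogeneous_factor _ (ord_le_pred _) low_x).
rewrite [RHS]mulrA divfK ?expf_neq0 //.
congr (_ * (_ * _)); rewrite exprM -[X in X ^+ ij.2]exprM; congr (_ ^+ _).
by rewrite -[RHS]xQ expnD -(expnS q mu.+1).
Qed.

Let deg_inj : injective deg.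
Proof.
move=> [i j] [k l] /addnI /= ijkl.
have ik : i = k :> nat.
  have := congr1 (modn^~ q) ijkl.
  by rewrite ![(_ + q * _)%N]addnC ![(q * _)%N]mulnC !modnMDl !modn_small.
have jl : j = l :> nat.
  by move: ijkl; rewrite ik => /addnI/eqP; rewrite eqn_pmul2l // => /eqP.
by congr (_, _); apply: val_inj.
Qed.

Let deg_lt ij : (deg ij < q * (m + 2))%N.
Proof.
case: ij => i j; rewrite /deg /= mulnDr.
have : (q * j <= q * m)%N by rewrite leq_mul2l -ltnS ltn_ord orbT.
by have := ltn_ord i; lia.
Qed.

Let size_low_factor ij : (size (low_factor ij) <= 2 * m * q.-1 + m.+1)%N.
Proof.
have size_low : (size low <= (2 * m).+1)%N.
  apply: leq_trans (size_polyD _ _) _; rewrite size_polyN geq_max.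
  rewrite size_frobenius_poly_leq ?andbT //.
  by apply: leq_trans (size_scale_leq _ _) _; rewrite size_polyXn; lia.
apply: leq_trans (size_homogeneous_factor_leq _ (ord_le_pred _) size_low) _.
rewrite -addnS leq_add //.
by rewrite mulnAC [leqRHS]mulnC leq_mul2l; have := ord_le_pred ij.1; lia.
Qed.

Let size_high_factor ij : size (high_factor ij) = (M * deg ij).+1.
Proof.
have size_high : size high = (2 * M).+1.
  exact: size_frobenius_poly (ltnW q_gt2) a_neq0.
rewrite (size_homogeneous_factor _ (ord_le_pred _) size_high) /deg.
by congr _.+1; ring.
Qed.

Let more_unknowns :
  (M * (M * M + (2 * m * q.-1 + m.+1)) < M * M * #|{: 'I_q * 'I_m.+1}|)%N.
Proof.
rewrite card_prod !card_ord -[(M * M * _)%N]mulnA.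
rewrite ltn_pmul2l ?ME ?muln_gt0 ?q_gt0 ?m_gt0 //.
by case: q q_gt2 => // p; move: m m_gt0 => n; rewrite /=; nia.
Qed.

Lemma card_frobenius_sum_fiber_leq (s : seq F) : uniq s ->
    {in s, forall x, [/\ x != 0, x ^+ (q ^ (mu.+1 + mu.+2)) = x &
                        frobenius_sum q a b (mu.+1 + mu.+2) x = c]} ->
  (size s <= q ^ mu.+1 * q ^ mu.+1 + 2 * q * q ^ mu.+1)%N.
Proof.
move=> uniq_s sol_s; rewrite -/M.
have M_gt0 : (0 < M)%N by rewrite expn_gt0 q_gt0.
have pcharM : [pchar F].-nat M by rewrite pnatX pcharq.
have : (size s * M < M * M * (q * (m + 2)))%N.
  apply: (stepanov (v := high_factor) M_gt0 pcharM size_low_factor more_unknowns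
    _ deg_inj) => //.
  - by move=> ij; rewrite -size_poly_eq0 size_high_factor.
  - by move=> ij; rewrite size_high_factor /= mulnA.
  - by move=> x /sol_s; apply: horner_high_factor.
rewrite -mulnA mulnCA [(size s * M)%N]mulnC ltn_pmul2l // => /ltnW/leq_trans-> //.
by rewrite ME; apply/eq_leq; ring.
Qed.

End FrobeniusSumFiber.

(** * The L-function of a Kloosterman sum *)

Lemma sum_count_mem (T : finType) (s : seq T) : (\sum_(x : T) count_mem x s = size s)%N.
Proof.
elim: s => [|y s IHs]; first by rewrite big1.
by rewrite /= big_split /= IHs (bigD1 y) //= eqxx big1 // => x /negPf;
  rewrite eq_sym => ->.
Qed.

Lemma sum_multiples_leq (m v n : nat) : (0 < m)%N -> (m * v <= n)%N ->
  (\sum_(j < n.+1) [&& 0 < j, m %| j & j %/ m <= v] = v)%N.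
Proof.
move=> m_gt0 le_mv.
rewrite -(big_mkord xpredT (fun j => [&& 0 < j, m %| j & j %/ m <= v]%N : nat)).
rewrite big_ltn // add0n.
rewrite (big_cat_nat (n := (m * v).+1)) //= [X in (_ + X)%N]big_nat.
rewrite [X in (_ + X)%N]big1 ?addn0.
  rewrite -[RHS](mulKn v m_gt0) divn_count_dvd.
  apply: eq_big_nat => j /andP[-> le_j] /=.
  case: dvdnP le_j => //= -[k ->]; rewrite mulnK // ltnS mulnC leq_pmul2l //.
  by move=> ->.
move=> j /andP[lt_j _]; apply/eqP; rewrite eqb0 !negb_and -leqNgt -ltnNge.
case: dvdnP lt_j => [[k ->]|_ _];
  rewrite ?orbT // mulnK // [(k * m)%N]mulnC ltn_pmul2l //.
by move=> ->; rewrite !orbT.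
Qed.

Section OrbitCount.
Variables (T : finType) (f : T -> T).
Hypothesis f_inj : injective f.

Lemma iter_order_dvdn (x : T) j : (iter j f x == x) = (order f x %| j)%N.
Proof.
have iter_mul k : iter (k * order f x) f x = x.
  by elim: k => // k IHk; rewrite mulSn iterD IHk iter_order.
apply/eqP/dvdnP => [jx|[k ->] //].
exists (j %/ order f x)%N; rewrite {1}(divn_eq j (order f x)).
suff -> : (j %% order f x = 0)%N by rewrite addn0.
have lt_m : (j %% order f x < order f x)%N by rewrite ltn_mod order_gt0.
rewrite -(findex_iter lt_m); apply/eqP; rewrite findex_eq0 eq_sym.
by move: jx; rewrite {1}(divn_eq j (order f x)) addnC iterD iter_mul => ->.
Qed.

Lemma count_traject_order (x y : T) k :
  count_mem y (traject f x (k * order f x)) = (k * (y \in orbit f x))%N.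
Proof.
elim: k => [|k IHk]; first by rewrite mul0n.
rewrite !mulSn trajectD count_cat iter_order // IHk.
by rewrite -/(orbit f x) count_uniq_mem ?orbit_uniq.
Qed.

Lemma count_mem_orbit (s : seq T) (x y : T) :
  perm_eq (map f s) s -> y \in orbit f x -> count_mem y s = count_mem x s.
Proof.
move=> /permP f_s; rewrite -fconnect_orbit => /iter_findex <-.
elim: (findex f x y) => //= i <-; rewrite -f_s count_map.
by apply: eq_count => z /=; rewrite (inj_eq f_inj).
Qed.

(* For a root [x] of multiplicity [v], the traject of [x] of length [j] closes up
   and is contained in [s] exactly for [j = k * order f x] with [0 < k <= v]. *)
Lemma sum_closed_traject (s : seq T) : perm_eq (map f s) s ->
  (\sum_(j < (size s).+1) \sum_(x : T)
    [&& 0 < j, iter j f x == x &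
       [forall y, count_mem y (traject f x j) <= count_mem y s]] = size s)%N.
Proof.
move=> f_s; rewrite exchange_big -[RHS]sum_count_mem; apply: eq_bigr => x _ /=.
set v := count_mem x s; set m := order f x.
have m_gt0 : (0 < m)%N by exact: order_gt0.
have le_mv : (m * v <= size s)%N.
  rewrite -sum_count_mem (bigID [in orbit f x]) /=.
  rewrite (eq_bigr (fun=> v)) => [|y]; last exact: count_mem_orbit.
  by rewrite sum_nat_const (card_uniqP (orbit_uniq f x)) size_orbit leq_addr.
rewrite -[RHS](sum_multiples_leq m_gt0 le_mv); apply: eq_bigr => j _.
rewrite iter_order_dvdn -/m; case: dvdnP => [[k ->]|_]; last by rewrite !andbF.
rewrite mulnK //; congr (nat_of_bool (_ && _)).
apply/forallP/idP => [/(_ x)|kv y]; rewrite count_traject_order.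
  by rewrite -fconnect_orbit connect0 muln1.
by case: (boolP (y \in _)) => [/(count_mem_orbit f_s)->|_]; rewrite ?muln1 ?muln0.
Qed.

End OrbitCount.

Lemma size_monic_subXn (R : nzRingType) (f : {poly R}) : f \is monic ->
  (size (f - 'X^((size f).-1))%R <= (size f).-1)%N.
Proof.
move=> mf; apply/leq_sizeP => j; rewrite leq_eqVlt coefB coefXn => /predU1P[<-|lt_j].
  by rewrite eqxx -/(lead_coef f) (monicP mf) subrr.
by rewrite gtn_eqF // subr0 nth_default // (leq_trans (leqSpred _)).
Qed.

Section RootSums.
Variable F : fieldType.
Implicit Types f g : {poly F}.

(* The factor ['X] makes [root_sum] vanish on constants, where [(size f).-2] would
   truncate to the constant coefficient. *)
Definition root_sum f : F := - (f * 'X)`_(size f).-1.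
Definition root_inv_sum f : F := - f`_1 / f`_0.

Lemma root_sumM f g : f \is monic -> g \is monic ->
  root_sum (f * g) = root_sum f + root_sum g.
Proof.
move=> mf mg; have := size_monic_subXn mg; have := size_monic_subXn mf.
have /polySpred sf := monic_neq0 mf; have /polySpred sg := monic_neq0 mg.
rewrite /root_sum size_mul ?monic_neq0 // sf sg addnS addSn /=.
set n := (size f).-1; set m := (size g).-1.
set f' := f - 'X^n; set g' := g - 'X^m => size_f' size_g'.
have -> : f = 'X^n + f' by rewrite addrC subrK.
have -> : g = 'X^m + g' by rewrite addrC subrK.
have -> : ('X^n + f') * ('X^m + g') * 'X =
    'X^((n + m).+1) + f' * 'X * 'X^m + g' * 'X * 'X^n + f' * g' * 'X.
  by rewrite exprSr exprD; ring.
rewrite !(mulrDl _ _ 'X) -!exprSr !(coefD, coefXn, coefMXn).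
rewrite !ltnNge leq_addl leq_addr addnK addKn !(ltn_eqF (ltnSn _)) !add0r.
rewrite [(f' * g' * 'X)`_ _]coefMX [X in - (_ + X)](_ : _ = 0) ?addr0 ?opprD //.
case: eqP => // /eqP nm; rewrite nth_default //.
apply: leq_trans (size_polyMleq _ _) _; rewrite -!subn1 leq_sub2r //.
exact: leq_add.
Qed.

Lemma root_inv_sumM f g : f`_0 != 0 -> g`_0 != 0 ->
  root_inv_sum (f * g) = root_inv_sum f + root_inv_sum g.
Proof.
move=> f0 g0; rewrite /root_inv_sum !coefM !big_ord_recl !big_ord0 /=.
by rewrite /bump /= !subn0 !addr0; field; rewrite f0 g0.
Qed.

Lemma root_sum1 : root_sum 1 = 0.
Proof. by rewrite /root_sum size_poly1 mul1r coefX oppr0. Qed.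

Lemma root_inv_sum1 : root_inv_sum 1 = 0.
Proof. by rewrite /root_inv_sum !coef1 oppr0 mul0r. Qed.

Lemma root_sum_XsubC r : root_sum ('X - r%:P) = r.
Proof. by rewrite /root_sum size_XsubC coefMX /= coefB coefX coefC sub0r opprK. Qed.

Lemma root_inv_sum_XsubC r : root_inv_sum ('X - r%:P) = r^-1.
Proof.
by rewrite /root_inv_sum !coefB !coefX !coefC /= subr0 sub0r invrN mulrNN mul1r.
Qed.

Lemma root_sum_prod (s : seq F) :
  root_sum (\prod_(r <- s) ('X - r%:P)) = \sum_(r <- s) r.
Proof.
elim: s => [|r s IHs]; first by rewrite !big_nil root_sum1.
by rewrite !big_cons root_sumM ?monicXsubC ?monic_prod_XsubC // IHs root_sum_XsubC.
Qed.

Lemma root_inv_sum_prod (s : seq F) : 0 \notin s ->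
  root_inv_sum (\prod_(r <- s) ('X - r%:P)) = \sum_(r <- s) r^-1.
Proof.
elim: s => [|r s IHs]; first by rewrite !big_nil root_inv_sum1.
rewrite inE negb_or => /andP[r0 s0]; rewrite !big_cons root_inv_sumM.
- by rewrite IHs // root_inv_sum_XsubC.
- by rewrite coefB coefX coefC sub0r oppr_eq0 eq_sym.
by rewrite -horner_coef0 -/(root _ 0) root_prod_XsubC.
Qed.

End RootSums.

Section RootSumsMap.
Variables (F F' : fieldType) (phi : {rmorphism F -> F'}).

Lemma root_sum_map (f : {poly F}) : root_sum (map_poly phi f) = phi (root_sum f).
Proof.
by rewrite /root_sum size_map_poly !coefMX rmorphN coef_map; case: eqP;
  rewrite ?rmorph0.
Qed.

Lemma root_inv_sum_map (f : {poly F}) :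
  root_inv_sum (map_poly phi f) = phi (root_inv_sum f).
Proof. by rewrite /root_inv_sum !coef_map rmorphM rmorphN fmorphV. Qed.

End RootSumsMap.

Lemma natr_card_gt0 (R : numDomainType) (K : finFieldType) : 0 < #|K|%:R :> R.
Proof. by rewrite ltr0n (ltnW (finNzRing_gt1 K)). Qed.

Lemma odd_card_gt2 (K : finFieldType) : odd #|K| -> (2 < #|K|)%N.
Proof. by have := finNzRing_gt1 K; case: #|K| => [|[|[]]]. Qed.

Record nontrivial_char (V : zmodType) (C : nzRingType) (psi : V -> C) : Prop :=
  NontrivialChar {
    char0 : psi 0 = 1;
    charD : {morph psi : x y / x + y >-> x * y};
    char_neq1 : exists y, psi y != 1 }.

Definition kloosterman (K : finFieldType) (C : nzRingType) (psi : K -> C)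
    (a b : K) : C :=
  \sum_(x | x != 0) psi (a * x + b / x).

Lemma mul_fixed_eq0 (C : idomainType) (c s : C) : c != 1 -> s = c * s -> s = 0.
Proof.
move=> c1 /eqP; rewrite -subr_eq0 -{1}[s]mul1r -mulrBl mulf_eq0 subr_eq0 eq_sym.
by rewrite (negPf c1) => /eqP.
Qed.

Lemma sum_nontrivial_char (V : finZmodType) (C : idomainType) (psi : V -> C) :
  nontrivial_char psi -> \sum_x psi x = 0.
Proof.
move=> psiP; have [y psiy] := char_neq1 psiP; apply: mul_fixed_eq0 psiy _.
rewrite {1}(reindex_inj (addrI y)) mulr_sumr; apply: eq_bigr => x _.
by rewrite (charD psiP).
Qed.

Section CharMul.
Variables (K : finFieldType) (C : idomainType) (psi : K -> C).
Hypothesis psiP : nontrivial_char psi.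

Lemma nontrivial_char_mul c : c != 0 -> nontrivial_char (fun y => psi (c * y)).
Proof.
move=> c0; split=> [|x y|]; first by rewrite mulr0 (char0 psiP).
  by rewrite mulrDr (charD psiP).
by have [y psiy] := char_neq1 psiP; exists (y / c); rewrite mulrC divfK.
Qed.

Lemma sum_char_mul c : \sum_y psi (c * y) = if c == 0 then #|K|%:R else 0.
Proof.
case: eqP => [->|/eqP c0]; last exact: sum_nontrivial_char (nontrivial_char_mul c0).
by under eq_bigr do rewrite mul0r (char0 psiP); rewrite sumr_const.
Qed.

Lemma kloostermanr0 a : a != 0 -> kloosterman psi a 0 = -1.
Proof.
move=> a0; have := sum_nontrivial_char (nontrivial_char_mul a0).
rewrite (bigD1 0) //= mulr0 (char0 psiP) => /eqP; rewrite addrC addr_eq0 => /eqP <-.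
by apply: eq_bigr => x _; rewrite mul0r addr0.
Qed.

End CharMul.

Section LFunction.
Variables (K : finFieldType) (C : fieldType) (psi : K -> C) (a b : K).
Hypotheses (psiP : nontrivial_char psi) (a0 : a != 0) (b0 : b != 0).

Definition Lchar (f : {poly K}) : C :=
  if f`_0 == 0 then 0 else psi (a * root_sum f + b * root_inv_sum f).

Definition monic_rV n (v : 'rV[K]_n) : {poly K} := 'X^n + rVpoly v.

(* The coefficient of [T ^ n] in the [L]-function, the sum of [Lchar f * T ^ deg f]
   over all monic [f]. *)
Definition Lcoef n : C := \sum_(v : 'rV[K]_n) Lchar (monic_rV v).

Lemma LcharM f g : f \is monic -> g \is monic -> Lchar (f * g) = Lchar f * Lchar g.
Proof.
move=> mf mg; rewrite /Lchar coefM big_ord_recl big_ord0 addr0 /= subn0 mulf_eq0.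
case: eqP => [_|/eqP f0]; first by rewrite mul0r.
case: eqP => [_|/eqP g0] /=; first by rewrite mulr0.
by rewrite root_sumM // root_inv_sumM // -(charD psiP); congr psi; ring.
Qed.

Lemma size_monic_rV n (v : 'rV[K]_n) : size (monic_rV v) = n.+1.
Proof. by rewrite size_polyDl size_polyXn // ltnS size_poly. Qed.

Lemma monic_rV_monic n (v : 'rV[K]_n) : monic_rV v \is monic.
Proof. by rewrite monicE lead_coefDl ?lead_coefXn // size_polyXn ltnS size_poly. Qed.

Lemma monic_rVK n (f : {poly K}) : f \is monic -> size f = n.+1 ->
  monic_rV (poly_rV (f - 'X^n) : 'rV[K]_n) = f.
Proof.
move=> mf size_f; rewrite /monic_rV poly_rV_K; first by rewrite addrC subrK.
by have := size_monic_subXn mf; rewrite size_f.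
Qed.

Lemma monic_rV_inj n : injective (@monic_rV n).
Proof. by move=> u v /addrI/(can_inj rVpolyK). Qed.

Lemma sum_dvdp_Lchar n j (h : {poly K}) : h \is monic -> size h = j.+1 -> (j <= n)%N ->
  \sum_(v : 'rV[K]_n | h %| monic_rV v) Lchar (monic_rV v) = Lchar h * Lcoef (n - j).
Proof.
move=> mh size_h le_jn; have h0 := monic_neq0 mh.
pose mul_h (u : 'rV[K]_(n - j)) : 'rV[K]_n := poly_rV (h * monic_rV u - 'X^n).
pose div_h (v : 'rV[K]_n) : 'rV[K]_(n - j) := poly_rV (monic_rV v %/ h - 'X^(n - j)).
have mul_hE u : monic_rV (mul_h u) = h * monic_rV u.
  rewrite monic_rVK ?monicMr ?monic_rV_monic // size_mul ?monic_neq0 ?monic_rV_monic //.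
  by rewrite size_h size_monic_rV addnS /= addSn subnKC.
have div_hE v : h %| monic_rV v -> h * monic_rV (div_h v) = monic_rV v.
  move=> /divpK hv; rewrite mulrC monic_rVK //.
    by move: (monic_rV_monic v); rewrite -{1}hv monicMr.
  by rewrite size_divp // size_h size_monic_rV subSn.
rewrite (reindex_onto mul_h div_h) /= => [|v hv]; last first.
  by apply: monic_rV_inj; rewrite mul_hE div_hE.
rewrite mulr_sumr; apply: eq_big => [u|u _];
  last by rewrite mul_hE LcharM ?monic_rV_monic.
rewrite mul_hE dvdp_mulr //=; apply/eqP/monic_rV_inj/(mulfI h0).
by rewrite div_hE mul_hE // dvdp_mulr.
Qed.

Lemma Lcoef0 : Lcoef 0 = 1.
Proof.
rewrite /Lcoef (big_pred1 0) => [|v]; last by symmetry; apply/eqP/rowP; case.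
rewrite /monic_rV linear0 addr0 /Lchar coef1 oner_eq0 root_sum1 root_inv_sum1.
by rewrite !mulr0 addr0 (char0 psiP).
Qed.

Lemma Lcoef1 : Lcoef 1 = kloosterman psi a b.
Proof.
rewrite /Lcoef /kloosterman (reindex (fun x : K => (const_mx (- x) : 'rV[K]_1))) /=.
  rewrite [RHS]big_mkcond; apply: eq_bigr => x _.
  have -> : monic_rV (const_mx (- x) : 'rV_1) = 'X - x%:P.
    rewrite /monic_rV expr1 -polyCN; congr (_ + _).
    by rewrite /rVpoly poly_def big_ord1 expr0 alg_polyC insubT //= mxE.
  rewrite /Lchar root_sum_XsubC root_inv_sum_XsubC coefB coefX coefC sub0r oppr_eq0.
  by case: (x == 0).
exists (fun v : 'rV_1 => - v 0 0) => [x _|v _]; first by rewrite mxE opprK.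
by apply/rowP => i; rewrite ord1 mxE opprK.
Qed.

Lemma Lchar_monic_rV n (v : 'rV[K]_n.+2) : Lchar (monic_rV v) =
  if v 0 0 == 0 then 0 else psi (- a * v 0 ord_max - b * v 0 1 / v 0 0).
Proof.
have coef_rV (k : 'I_n.+2) : (monic_rV v)`_k = v 0 k.
  by rewrite coefD coefXn ltn_eqF // add0r coef_rVpoly_ord.
rewrite /Lchar /root_sum /root_inv_sum size_monic_rV coefMX /=.
rewrite (coef_rV 0) (coef_rV 1) (coef_rV ord_max).
by case: eqP => // _; congr psi; ring.
Qed.

Lemma Lcoef2 : Lcoef 2 = #|K|%:R.
Proof.
pose row2 (u : K * K) : 'rV[K]_2 := \row_i (if i == 0 then u.1 else u.2).
have LcharE x y : x != 0 -> Lchar (monic_rV (row2 (x, y))) = psi ((- a - b / x) * y).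
  move=> x0; rewrite Lchar_monic_rV !mxE /= (negPf x0); congr psi; field.
  exact: x0.
rewrite /Lcoef (reindex row2) /=; last first.
  exists (fun v : 'rV_2 => (v 0 0, v 0 1)) => [[x y] _|v _]; first by rewrite !mxE.
  apply/rowP => i; rewrite mxE; case: i => [[|[|]]] //= lt_i; congr (v 0 _);
    exact: val_inj.
rewrite -(pair_bigA _ (fun x y => Lchar (monic_rV (row2 (x, y))))) /=.
have ba0 : - (b / a) != 0 by rewrite oppr_eq0 mulf_neq0 ?invr_eq0.
rewrite (bigD1 (- (b / a))) //= [X in _ + X]big1 => [|x x_ba].
  under eq_bigr => y _ do rewrite LcharE //.
  rewrite (sum_char_mul psiP) addr0 ifT //; apply/eqP; field.
  by rewrite oppr_eq0 a0 b0.
have [->|x0] := eqVneq x 0.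
  by rewrite big1 // => y _; rewrite Lchar_monic_rV !mxE /= eqxx.
under eq_bigr => y _ do rewrite LcharE //.
rewrite (sum_char_mul psiP) ifN // -opprD oppr_eq0; apply: contra x_ba => ab0.
by apply/eqP; move: ab0; rewrite addr_eq0 => /eqP->; field; rewrite oppr_eq0 x0 b0.
Qed.

(* Translating the coefficient of ['X^n.+2], on which [Lchar] depends through the
   factor [psi (- a * _)] only. *)
Lemma Lcoef_ge3 n : Lcoef n.+3 = 0.
Proof.
have Na0 : - a != 0 by rewrite oppr_eq0.
have [y psiy] := char_neq1 (nontrivial_char_mul psiP Na0).
apply: mul_fixed_eq0 psiy _; pose d : 'rV[K]_n.+3 := y *: delta_mx 0 ord_max.
rewrite {1}/Lcoef (reindex_inj (addrI d)) mulr_sumr.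
apply: eq_bigr => v _; rewrite !Lchar_monic_rV /d !mxE /= ?eqxx !mulr0 !add0r mulr1.
case: eqP => _; first by rewrite mulr0.
by rewrite -(charD psiP); congr psi; rewrite mulrDr addrA.
Qed.

End LFunction.

Definition pchar_exp (R : comNzRingType) (q : nat) of [pchar R].-nat q :=
  fun x : R => x ^+ q.

Section PcharExp.
Variables (R : comNzRingType) (q : nat) (pcharq : [pchar R].-nat q).

Fact pchar_exp_is_zmod_morphism : zmod_morphism (pchar_exp pcharq).
Proof. by move=> x y; rewrite /pchar_exp exprDn_pchar // exprNn_pchar. Qed.

Fact pchar_exp_is_monoid_morphism : monoid_morphism (pchar_exp pcharq).
Proof. by split=> [|x y]; rewrite /pchar_exp ?expr1n ?exprMn. Qed.

HB.instance Definition _ :=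
  GRing.isZmodMorphism.Build R R (pchar_exp pcharq) pchar_exp_is_zmod_morphism.
HB.instance Definition _ :=
  GRing.isMonoidMorphism.Build R R (pchar_exp pcharq) pchar_exp_is_monoid_morphism.
End PcharExp.

Lemma dvdp_prod_XsubC_count (L : finFieldType) (s t : seq L) :
  (\prod_(x <- s) ('X - x%:P) %| \prod_(x <- t) ('X - x%:P)) =
  [forall y, count_mem y s <= count_mem y t]%N.
Proof.
have nz (u : seq L) : \prod_(x <- u) ('X - x%:P) != 0.
  by rewrite monic_neq0 // monic_prod_XsubC.
apply/idP/forallP => [st y|/count_subseqP[u /subseqP[m _ ->] su]].
  rewrite -mu_prod_XsubC -[leqRHS]mu_prod_XsubC mup_geq //.
  by apply: dvdp_trans st; rewrite -mup_geq.
rewrite (perm_big _ su) /=; elim: t m {su} => [|x t IHt] [|[] m] //=;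
  rewrite ?big_nil ?dvd1p // !big_cons.
  by rewrite dvdp_mul.
exact: dvdp_mull.
Qed.

Section Descent.
Variables (K L : finFieldType) (phi : {rmorphism K -> L}).
Let q := #|K|.
Let frob (x : L) := x ^+ q.

Lemma pchar_card_subfield : [pchar L].-nat q.
Proof.
have [p _ pK] := finPcharP K.
have pL : p \in [pchar L] by rewrite (rmorph_pchar phi).
by rewrite /q (card_pprimeChar pK) pnatX pnatE ?(pcharf_prime pK) ?pL.
Qed.

Let frobM : {rmorphism L -> L} := pchar_exp pchar_card_subfield.

Lemma iter_exp_card j (x : L) : iter j frob x = x ^+ (q ^ j).
Proof. by elim: j => //= j ->; rewrite /frob -exprM expnSr. Qed.

Lemma exp_card_fixed (y : L) : y ^+ q = y -> exists x, y = phi x.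
Proof.
move=> yq; have := congr1 (fun p => (map_poly phi p).[y]) (finField_genPoly K).
rewrite rmorphB rmorphXn /= map_polyX !hornerE yq subrr rmorph_prod horner_prod.
move/esym/eqP/prodf_eq0 => [x _ /eqP/esym].
rewrite rmorphB /= map_polyX map_polyC !hornerE.
by move/esym/eqP; rewrite subr_eq0 => /eqP; exists x.
Qed.

Definition descend (y : L) : K := odflt 0 [pick x | phi x == y].

Lemma descendK : cancel phi descend.
Proof.
move=> x; rewrite /descend; case: pickP => [z /eqP/fmorph_inj //|/(_ x)].
by rewrite eqxx.
Qed.

Lemma descend_fixed y : y ^+ q = y -> phi (descend y) = y.
Proof. by move=> /exp_card_fixed[x ->]; rewrite descendK. Qed.

Lemma map_poly_descend (p : {poly L}) : map_poly frobM p = p ->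
  map_poly phi (map_poly descend p) = p.
Proof.
move=> frob_p; have descend0 : descend 0 = 0 by rewrite -(rmorph0 phi) descendK.
apply/polyP => k; rewrite coef_map /= coef_map_id0 // descend_fixed //.
by have := congr1 (fun p : {poly L} => p`_k) frob_p; rewrite coef_map.
Qed.

Lemma map_frob_prod_XsubC (s : seq L) :
  map_poly frobM (\prod_(y <- s) ('X - y%:P)) = \prod_(y <- map frob s) ('X - y%:P).
Proof.
rewrite rmorph_prod big_map; apply: eq_bigr => y _.
by rewrite rmorphB /= map_polyX map_polyC.
Qed.

Definition orbit_prod (x : L) j : {poly L} := \prod_(y <- traject frob x j) ('X - y%:P).
Definition orbit_poly (x : L) j : {poly K} := map_poly descend (orbit_prod x j).

Lemma map_orbit_poly x j :
  x ^+ (q ^ j) = x -> map_poly phi (orbit_poly x j) = orbit_prod x j.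
Proof.
rewrite -iter_exp_card => jx; apply: map_poly_descend.
rewrite map_frob_prod_XsubC; apply: perm_big.
have -> : map frob (traject frob x j) = traject frob (frob x) j.
  by elim: j x {jx} => //= j IHj x; rewrite IHj.
by rewrite -(perm_cons x) -trajectS trajectSr jx perm_sym -perm_rcons.
Qed.

(* The pairs [(j, x)] stand for the monic divisors of [f] that are powers of monic
   irreducible polynomials, marked at one of their roots. *)
Lemma sum_orbit_poly_dvdp (f : {poly K}) n : size f = n.+1 ->
    (exists rs, map_poly phi f = \prod_(r <- rs) ('X - r%:P)) ->
  (\sum_(j < n.+1) \sum_(x : L)
    [&& 0 < j, x ^+ (q ^ j) == x & (orbit_poly x j %| f)%R] = n)%N.
Proof.
move=> size_f [rs fE].
have size_rs : size rs = n.
  by have := congr1 (size \o polyseq) fE;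
    rewrite /= size_map_poly size_f size_prod_XsubC => -[].
have frob_rs : perm_eq (map frob rs) rs.
  apply: prod_XsubC_eq; rewrite -map_frob_prod_XsubC -fE -map_poly_comp.
  by apply: eq_map_poly => x; rewrite /= /pchar_exp -rmorphXn expf_card.
have frob_inj : injective frob := fmorph_inj frobM.
rewrite -[RHS]size_rs -(sum_closed_traject frob_inj frob_rs) size_rs.
apply: eq_bigr => j _; apply: eq_bigr => x _; rewrite iter_exp_card.
case: (0 < j)%N => //=; case: eqP => //= jx; congr nat_of_bool.
by rewrite -(dvdp_map phi) map_orbit_poly // fE dvdp_prod_XsubC_count.
Qed.

End Descent.

Section Newton.
Variables (K : finFieldType) (C : fieldType) (psi : K -> C) (a b : K).
Hypotheses (psiP : nontrivial_char psi).
Variables (L : finFieldType) (phi : {rmorphism K -> L}).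
Let q := #|K|.

(* The coefficient of [T ^ j] in the logarithmic derivative [T * L' / L]. *)
Definition Lpower_sum j : C :=
  \sum_(x : L | x ^+ (q ^ j) == x) Lchar psi a b (orbit_poly phi x j).

Lemma newton_identity n :
    (forall f : {poly K}, f \is monic -> size f = n.+1 ->
       exists rs, map_poly phi f = \prod_(r <- rs) ('X - r%:P)) ->
  n%:R * Lcoef psi a b n =
    \sum_(j < n.+1 | (0 < j)%N) Lpower_sum j * Lcoef psi a b (n - j).
Proof.
move=> split_n; rewrite {1}/Lcoef mulr_sumr.
under eq_bigr => v _.
  have split_v := split_n _ (monic_rV_monic v) (size_monic_rV v).
  rewrite -{1}(sum_orbit_poly_dvdp (size_monic_rV v) split_v) natr_sum mulr_suml.
  under eq_bigr do rewrite natr_sum mulr_suml.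
  over.
rewrite exchange_big [RHS]big_mkcond /=; apply: eq_bigr => j _.
rewrite exchange_big /=; case: (posnP j) => [->|j_gt0].
  by rewrite big1 // => x _; rewrite big1 // => v _; rewrite mul0r.
rewrite /Lpower_sum mulr_suml [RHS]big_mkcond; apply: eq_bigr => x _ /=.
case: eqP => [jx|_]; last by rewrite big1 // => v _; rewrite mul0r.
have hE := map_orbit_poly phi jx; set h := orbit_poly phi x j in hE *.
have mh : h \is monic by rewrite -(map_monic phi) hE monic_prod_XsubC.
have size_h : size h = j.+1.
  by rewrite -(size_map_poly phi) hE size_prod_XsubC size_traject.
have le_jn : (j <= n)%N by rewrite -ltnS.
rewrite -(sum_dvdp_Lchar a b psiP mh size_h le_jn) [RHS]big_mkcond.
by apply: eq_bigr => v _; case: (h %| _); rewrite ?mul1r ?mul0r.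
Qed.

Section OrbitPoly.
Variables (x : L) (j : nat).
Hypotheses (j_gt0 : (0 < j)%N) (jx : x ^+ (q ^ j) = x).

Let mem0_traject : (0 \in traject (fun y : L => y ^+ q) x j) = (x == 0).
Proof.
apply/idP/eqP => [/trajectP[i _]|->]; last first.
  by case: j j_gt0 => //= k _; rewrite inE eqxx.
by rewrite iter_exp_card => /esym/eqP; rewrite expf_eq0 => /andP[_ /eqP].
Qed.

Lemma frobenius_sum_orbit_poly : x != 0 -> frobenius_sum q (phi a) (phi b) j x =
  phi (a * root_sum (orbit_poly phi x j) + b * root_inv_sum (orbit_poly phi x j)).
Proof.
move=> x0; rewrite rmorphD (rmorphM phi a) (rmorphM phi b).
rewrite -root_sum_map -root_inv_sum_map (map_orbit_poly phi jx).
rewrite root_sum_prod root_inv_sum_prod ?mem0_traject // !mulr_sumr -big_split /=.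
rewrite (big_nth x) size_traject big_mkord; apply: eq_bigr => i _.
by rewrite nth_traject // iter_exp_card exprVn.
Qed.

Lemma descend_frobenius_sum : x != 0 ->
  phi (descend phi (frobenius_sum q (phi a) (phi b) j x)) =
    frobenius_sum q (phi a) (phi b) j x.
Proof. by move=> x0; rewrite frobenius_sum_orbit_poly // descendK. Qed.

Lemma Lchar_orbit_poly : Lchar psi a b (orbit_poly phi x j) =
  if x == 0 then 0 else psi (descend phi (frobenius_sum q (phi a) (phi b) j x)).
Proof.
have coef0 : ((orbit_poly phi x j)`_0 == 0) = (x == 0).
  rewrite -(fmorph_eq0 phi) -coef_map map_orbit_poly // -horner_coef0 -/(root _ 0).
  by rewrite root_prod_XsubC mem0_traject.
rewrite /Lchar coef0; case: eqP => // /eqP x0; congr psi.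
by rewrite frobenius_sum_orbit_poly // descendK.
Qed.

End OrbitPoly.

End Newton.

(** * The Weil bound for Kloosterman sums *)

Section Normc.
Variable R : rcfType.
Implicit Types z w : R[i].

Lemma normc_ge0 z : 0 <= normc z.
Proof. by case: z => x y; apply: sqrtr_ge0. Qed.

Lemma normc_real (x : R) : normc (x%:C)%C = `|x|.
Proof. by rewrite /= expr0n addr0 sqrtr_sqr. Qed.

Lemma normc_nat n : normc (n%:R : R[i]) = n%:R.
Proof. by rewrite -[n%:R](rmorph_nat (@real_complex R)) normc_real ger0_norm. Qed.

Lemma normcX z n : normc (z ^+ n) = normc z ^+ n.
Proof. by elim: n => [|n IHn]; rewrite ?expr0 ?normc1 // !exprS normcM IHn. Qed.

Lemma normc_conj z : normc (conjc z) = normc z.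
Proof. by case: z => x y /=; rewrite sqrrN. Qed.

Lemma sqr_normcC z : ((normc z ^+ 2)%:C)%C = z * conjc z.
Proof. by rewrite -sqr_normc rmorphXn. Qed.

Lemma le_normcB z w : normc z - normc w <= normc (z + w).
Proof. by rewrite lerBlDr -(normcN w) -[X in normc X <= _](addrK w) le_normcD. Qed.

Lemma le_normc_sum (I : Type) (r : seq I) (P : pred I) (F : I -> R[i]) :
  normc (\sum_(i <- r | P i) F i) <= \sum_(i <- r | P i) normc (F i).
Proof.
elim/big_rec2: _ => [|i y z _ le_zy]; first by rewrite normc0.
by apply: le_trans (le_normcD _ _) _; rewrite lerD2l.
Qed.

End Normc.

Section UnitaryChar.
Variables (R : rcfType) (K : finFieldType) (psi : K -> R[i]).
Hypothesis psiP : nontrivial_char psi.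

Lemma normc_char x : normc (psi x) = 1.
Proof.
have [p p_pr pK] := finPcharP K.
have psiMn n : psi (x *+ n) = psi x ^+ n.
  by elim: n => [|n IHn]; rewrite ?(char0 psiP) // mulrS (charD psiP) IHn exprS.
have := psiMn p; rewrite (mulrn_pchar pK) (char0 psiP) => /(congr1 (@normc R)).
rewrite normc1 normcX => /esym/eqP; rewrite pexpr_eq1 ?normc_ge0 ?prime_gt0 //.
by move/eqP.
Qed.

Lemma conjc_char x : conjc (psi x) = psi (- x).
Proof.
have psiN : psi x * psi (- x) = 1 by rewrite -(charD psiP) subrr (char0 psiP).
have psi_neq0 : psi x != 0.
  by apply: contra_eq_neq psiN => ->; rewrite mul0r eq_sym oner_eq0.
by apply: (mulfI psi_neq0); rewrite psiN -sqr_normcC normc_char expr1n.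
Qed.

(* The constant [B] may be subtracted from the weights, since [psi] sums to zero. *)
Lemma normc_sum_nat_char_le (w : K -> nat) (B : nat) : (forall x, w x <= B)%N ->
  normc (\sum_x (w x)%:R * psi x) <= (#|K| * B - \sum_x w x)%:R.
Proof.
move=> w_le; have -> : \sum_x (w x)%:R * psi x = - \sum_x (B - w x)%:R * psi x.
  apply/eqP; rewrite -addr_eq0 -big_split /=.
  rewrite (eq_bigr (fun x => B%:R * psi x)) => [|x _]; last by rewrite natrB //; ring.
  by rewrite -mulr_sumr (sum_nontrivial_char psiP) mulr0.
rewrite (normcN _); apply: le_trans (le_normc_sum _ _ _) _.
rewrite (eq_bigr (fun x => (B - w x)%:R)) => [|x _]; last first.
  by rewrite normcM normc_char mulr1 normc_nat.
rewrite -natr_sum ler_nat leq_subRL -?sum_nat_const; last exact: leq_sum.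
by rewrite -big_split /=; apply: leq_sum => x _; rewrite subnKC.
Qed.

End UnitaryChar.

Lemma sqrt_card_ge1 (R : rcfType) (K : finFieldType) : 1 <= Num.sqrt (#|K|%:R : R).
Proof. by rewrite -{1}sqrtr1 ler_wsqrtr // ler1n (ltnW (finNzRing_gt1 K)). Qed.

Lemma exists_splitting_extension (K : finFieldType) (N : nat) :
  exists (L : finFieldType) (phi : {rmorphism K -> L}), forall f : {poly K},
    f \is monic -> (size f <= N)%N ->
    exists rs, map_poly phi f = \prod_(r <- rs) ('X - r%:P).
Proof.
pose p : {poly K} := \prod_(v : 'rV[K]_N | rVpoly v != 0) rVpoly v.
have /FinSplittingFieldFor[L [rs pE _]] : p != 0 by apply/prodf_neq0.
exists (FinFieldExtType L), (in_alg L : {rmorphism K -> L}) => f mf sf.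
have fp : f %| p.
  rewrite /p (bigD1 (poly_rV f)) /= ?poly_rV_K ?monic_neq0 //.
  exact: dvdp_mulr.
have : map_poly (in_alg L) f %| \prod_(z <- rs) ('X - z%:P).
  by rewrite -(eqp_dvdr _ pE) dvdp_map.
case/dvdp_prod_XsubC=> m fE; exists (mask m rs); apply/eqP.
by rewrite -eqp_monic // ?monic_prod_XsubC ?map_monic.
Qed.

Lemma card_exp_fixed_ge (L : finFieldType) (Q : nat) (rs : seq L) : (1 < Q)%N ->
    [pchar L].-nat Q -> 'X^Q - 'X = \prod_(r <- rs) ('X - r%:P) ->
  (Q <= #|[set x : L | x ^+ Q == x]|)%N.
Proof.
move=> Q_gt1 pcharQ rsE; have size_rs : size rs = Q.
  have := congr1 (size \o polyseq) rsE; rewrite /= size_prod_XsubC.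
  by rewrite size_polyDl ?size_polyXn ?size_polyN ?size_polyX // => -[].
have uniq_rs : uniq rs.
  rewrite -separable_prod_XsubC -rsE unlock derivB derivXn derivX.
  have Q0 : Q%:R = 0 :> L.
    have [p _ pL] := finPcharP L.
    move: pcharQ Q_gt1; rewrite (eq_pnat _ (pcharf_eq pL)) => /p_natP[[|k] ->] // _.
    by rewrite expnS natrM (pcharf0 pL) mul0r.
  rewrite -mulr_natr -polyC_natr Q0 mulr0 sub0r -[X in coprimep _ X]scaleN1r.
  by rewrite coprimepZr ?oppr_eq0 ?oner_eq0 // coprimep1.
rewrite -[X in (X <= _)%N]size_rs -(card_uniqP uniq_rs); apply: subset_leq_card.
apply/subsetP => x x_rs; rewrite inE -subr_eq0.
have : root ('X^Q - 'X) x by rewrite rsE root_prod_XsubC.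
by rewrite rootE !hornerE.
Qed.

(* [- S j] is the [j]-th power sum of two numbers of product [c] and sum [- k]; the
   larger of them has modulus at least [2 * s]. *)
Lemma normc_recurrence_ge (R : rcfType) (S : nat -> R[i]) (k c : R[i]) (s : R)
    (n : nat) :
    0 <= s -> 3 * s <= normc k -> normc c = s ^+ 2 ->
    S 1%N = k -> ((2 <= n)%N -> S 2%N = 2 * c - k ^+ 2) ->
    (forall m, (m.+3 <= n)%N -> S m.+3 = - (c * S m.+1) - k * S m.+2) ->
  forall j, (0 < j <= n)%N -> (2 * s) ^+ j <= normc (S j).
Proof.
move=> s_ge0 k_ge normc_c S1 S2 rec_S; pose u j := normc (S j).
have u_ge0 j : 0 <= u j by exact: normc_ge0.
have step m : (m.+2 <= n)%N -> 2 * s * u m.+1 <= u m.+2.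
  elim: m => [|m IHm] le_mn.
    have : u 1%N ^+ 2 - 2 * s ^+ 2 <= u 2%N.
      rewrite /u S1 S2 // -normc_c -normcX -(normcN (k ^+ 2)).
      rewrite -[2 : R]normc_nat -normcM [2 * c - _]addrC; exact: le_normcB.
    by rewrite /u S1; nra.
  have := IHm (ltnW le_mn).
  have : normc k * u m.+2 - s ^+ 2 * u m.+1 <= u m.+3.
    rewrite /u rec_S // -normc_c -!normcM -(normcN (k * _)) -(normcN (c * _))
      [- (c * _) - _]addrC.
    exact: le_normcB.
  by have := u_ge0 m.+1; have := u_ge0 m.+2; nra.
elim=> // -[|j] IHj /andP[_ le_jn]; first by rewrite expr1 S1; lra.
rewrite exprS; apply: le_trans (step _ le_jn); apply: ler_wpM2l; first by lra.
by apply: IHj; rewrite /= ltnW.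
Qed.

Section KloostermanBound.
Variables (R : rcfType) (K : finFieldType) (psi : K -> R[i]) (a b : K).
Hypotheses (psiP : nontrivial_char psi) (a0 : a != 0) (b0 : b != 0).
Hypothesis oddK : odd #|K|.
Let q := #|K|.

Let q_gt2 : (2 < q)%N. Proof. exact: odd_card_gt2. Qed.

Section Extension.
Variables (L : finFieldType) (phi : {rmorphism K -> L}) (mu : nat).
Let n := (mu.+1 + mu.+2)%N.
Let Q := (q ^ n)%N.
Let M := (q ^ mu.+1)%N.
Hypothesis split_Q : exists rs, map_poly phi ('X^Q - 'X) = \prod_(r <- rs) ('X - r%:P).

Let Q_gt1 : (1 < Q)%N.
Proof. by rewrite -(exp1n n) ltn_exp2r ?(ltn_trans _ q_gt2). Qed.

Let trace (x : L) : K := descend phi (frobenius_sum q (phi a) (phi b) n x).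
Let card_fiber (c : K) := #|[set x : L | [&& x != 0, x ^+ Q == x & trace x == c]]|.

Let card_fiber_le c : (card_fiber c <= M * M + 2 * q * M)%N.
Proof.
rewrite /card_fiber cardE.
apply: (@card_frobenius_sum_fiber_leq L q mu (phi a) (phi b) (phi c)) => //.
- exact: pchar_card_subfield phi.
- by rewrite fmorph_eq0.
- exact: enum_uniq.
move=> x; rewrite mem_enum inE => /and3P[x0 /eqP xQ /eqP <-]; split=> //.
by rewrite /trace descend_frobenius_sum.
Qed.

Let sum_card_fiber_ge : (Q.-1 <= \sum_c card_fiber c)%N.
Proof.
have -> : (\sum_c card_fiber c)%N = #|[set x : L | (x != 0) && (x ^+ Q == x)]|.
  rewrite -sum1dep_card (partition_big trace xpredT) //=; apply: eq_bigr => c _.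
  by rewrite /card_fiber -sum1dep_card; apply: eq_bigl => x; rewrite andbA.
have [rs] := split_Q; rewrite rmorphB rmorphXn /= map_polyX => /card_exp_fixed_ge.
rewrite pnatX (pchar_card_subfield phi) => /(_ Q_gt1 isT).
rewrite (cardsD1 (0 : L)) inE expr0n (gtn_eqF (ltnW Q_gt1)) eqxx add1n.
rewrite -{1}(ltn_predK Q_gt1) ltnS => /leq_trans-> //.
by apply: subset_leq_card; apply/subsetP => x; rewrite !inE.
Qed.

Lemma normc_Lpower_sum_le : normc (Lpower_sum psi a b phi n) <= (2 * q ^ 2 * M + 1)%:R.
Proof.
have -> : Lpower_sum psi a b phi n = \sum_c (card_fiber c)%:R * psi c.
  transitivity (\sum_(x : L | (x != 0) && (x ^+ Q == x)) psi (trace x)).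
    rewrite [LHS]big_mkcond [RHS]big_mkcond; apply: eq_bigr => x _.
    case: eqP => [xQ|_]; last by rewrite andbF.
    by rewrite Lchar_orbit_poly // andbT; case: eqP.
  rewrite (partition_big trace xpredT) //=; apply: eq_bigr => c _.
  rewrite (eq_bigr (fun=> psi c)) => [|x /andP[_ /eqP->] //].
  rewrite sumr_const mulr_natl /card_fiber cardsE; congr (_ *+ _); apply: eq_card => x.
  by rewrite -!topredE /= andbA.
apply: le_trans (normc_sum_nat_char_le psiP card_fiber_le) _.
rewrite ler_nat leq_subLR mulnDr.
apply: leq_trans (leq_add sum_card_fiber_ge (leqnn _)).
have -> : (q * (2 * q * M) = 2 * q ^ 2 * M)%N by ring.
have <- : Q = (q * (M * M))%N by rewrite /Q /n addnS expnS expnD.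
by rewrite addn1 addnS -addSn prednK // ltnW.
Qed.

End Extension.

Lemma Lpower_sum_recurrence (L : finFieldType) (phi : {rmorphism K -> L}) (n : nat) :
    (forall f : {poly K}, f \is monic -> (size f <= n.+1)%N ->
       exists rs, map_poly phi f = \prod_(r <- rs) ('X - r%:P)) ->
  let S := Lpower_sum psi a b phi in let Kl := kloosterman psi a b in
  [/\ (1 <= n)%N -> S 1%N = Kl,
      (2 <= n)%N -> S 2%N = 2 * q%:R - Kl ^+ 2 &
      forall m, (m.+3 <= n)%N -> S m.+3 = - (q%:R * S m.+1) - Kl * S m.+2].
Proof.
move=> split_n S Kl.
have newton m : (m <= n)%N -> m%:R * Lcoef psi a b m =
    \sum_(j < m.+1 | (0 < j)%N) S j * Lcoef psi a b (m - j).
  move=> le_mn; apply: newton_identity => // f mf size_f.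
  by apply: split_n => //; rewrite size_f.
have S1 : (1 <= n)%N -> S 1%N = Kl.
  move=> /newton; rewrite mul1r Lcoef1 // -/Kl => ->.
  by rewrite big_mkcond !big_ord_recl big_ord0 /= add0r addr0 Lcoef0 ?mulr1.
have newton2 m : (m.+2 <= n)%N -> m.+2%:R * Lcoef psi a b m.+2 =
    (if m == 0 then 0 else S m * q%:R) + S m.+1 * Kl + S m.+2.
  move=> /newton->; rewrite big_mkcond !big_ord_recr /=.
  rewrite big1 ?add0r => [|j _]; last first.
    case: ifP => // _; have -> : (m.+2 - j = (m - j.+1).+3)%N by have := ltn_ord j; lia.
    by rewrite Lcoef_ge3 ?mulr0.
  rewrite subnn subSnn Lcoef0 // mulr1 Lcoef1 // -/Kl lt0n.
  rewrite (_ : (m.+2 - m = 2)%N) ?Lcoef2 //; last by lia.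
  by case: eqP.
split=> // [n_ge2|m le_mn].
  by have := newton2 0 n_ge2; rewrite Lcoef2 // S1 ?(ltnW n_ge2) //= add0r => ->; ring.
have /esym/eqP := newton2 m.+1 le_mn.
rewrite Lcoef_ge3 // mulr0 addrC addr_eq0 => /eqP-> /=.
ring.
Qed.

Lemma kloosterman_bound_neq0 : normc (kloosterman psi a b) <= 3 * Num.sqrt (q%:R : R).
Proof.
set s : R := Num.sqrt _.
have s2 : s ^+ 2 = q%:R by rewrite sqr_sqrtr ?ler0n.
have s_ge1 : 1 <= s := sqrt_card_ge1 R K.
rewrite leNgt; apply/negP => lt_Kl.
pose mu := (q ^ 2)%N; pose n := (mu.+1 + mu.+2)%N.
have [L [phi split_L]] := exists_splitting_extension K (q ^ n).+1.
have lower : (2 * s) ^+ n <= normc (Lpower_sum psi a b phi n).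
  have [S1 S2 rec_S] := @Lpower_sum_recurrence L phi n (fun f mf size_f =>
    split_L f mf (leqW (leq_trans size_f (ltn_expl n (ltnW q_gt2))))).
  apply: (normc_recurrence_ge (n := n) _ (ltW lt_Kl) _ (S1 isT) S2 rec_S) => //.
  - exact: le_trans s_ge1.
  - by rewrite normc_nat.
  - exact: leqnn.
have upper : normc (Lpower_sum psi a b phi n) <= (2 * q ^ 2 * q ^ mu.+1 + 1)%:R.
  have Q_gt1 : (1 < q ^ n)%N by rewrite -(exp1n n) ltn_exp2r ?(ltn_trans _ q_gt2).
  have lt_size : (size (- 'X : {poly K}) < size ('X^(q ^ n) : {poly K}))%N.
    by rewrite size_polyN size_polyX size_polyXn.
  apply: normc_Lpower_sum_le; apply: split_L.
    by rewrite monicE lead_coefDl ?lead_coefXn.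
  by rewrite size_polyDl // size_polyXn.
suff : ((2 * q ^ 2 * q ^ mu.+1 + 1)%:R : R) < (2 * s) ^+ n.
  by rewrite ltNge (le_trans lower upper).
have -> : (2 * s) ^+ n = (2 ^ n * q ^ mu.+1)%:R * s.
  rewrite exprMn (_ : n = (2 * mu.+1).+1) /n; last by lia.
  by rewrite [s ^+ _]exprSr exprM s2 natrM !natrX mulrA.
apply: (@lt_le_trans _ _ (2 ^ n * q ^ mu.+1)%:R); last by rewrite ler_peMr.
have M_gt0 : (0 < q ^ mu.+1)%N by rewrite expn_gt0 (ltnW (ltnW q_gt2)).
have lt_n : (2 * q ^ 2 + 1 < 2 ^ n)%N.
  have := ltn_expl mu (isT : (1 < 2)%N).
  by rewrite /n /mu addSn addnS addnS !expnS expnD; move: (q ^ 2)%N (2 ^ _)%N; nia.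
rewrite ltr_nat; apply: leq_ltn_trans (_ : _ <= (2 * q ^ 2 + 1) * q ^ mu.+1)%N _.
  by rewrite mulnDl leq_add2l mul1n.
by rewrite ltn_pmul2r.
Qed.

End KloostermanBound.

Lemma kloosterman_bound (R : rcfType) (K : finFieldType) (psi : K -> R[i]) (a b : K) :
    nontrivial_char psi -> odd #|K| -> a != 0 ->
  normc (kloosterman psi a b) <= 3 * Num.sqrt (#|K|%:R : R).
Proof.
move=> psiP oddK a0; have [->|b0] := eqVneq b 0; last exact: kloosterman_bound_neq0.
by rewrite (kloostermanr0 psiP a0) (normcN _) normc1; have := sqrt_card_ge1 R K; lra.
Qed.

(** * Gauss sums and Fourier analysis *)

Lemma exists_prime_primitive_root (C : closedFieldType) (p : nat) :
  prime p -> p%:R != 0 :> C -> exists z : C, p.-primitive_root z.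
Proof.
move=> p_pr p0; have p_gt1 := prime_gt1 p_pr.
have /closed_rootP[z] : size (\poly_(i < p) (1 : C)) != 1%N.
  by rewrite size_poly_eq ?oner_eq0 // gtn_eqF.
rewrite rootE horner_poly => /eqP z0.
have zp : z ^+ p = 1.
  apply/eqP; rewrite -subr_eq0 subrX1 -[X in _ * X](eq_bigr _ (fun i _ => mul1r _)).
  by rewrite z0 mulr0.
have [m prim_z mp] := prim_order_exists (ltnW p_gt1) zp.
case/primeP: (p_pr) => _ /(_ m mp)/pred2P[m1|<-]; last by exists z.
move: prim_z z0; rewrite m1 => /prim_expr_order; rewrite expr1 => ->.
under eq_bigr do rewrite expr1n mulr1.
by rewrite sumr_const card_ord => /eqP; rewrite (negPf p0).
Qed.

Lemma exists_nontrivial_char (K : finFieldType) (C : closedFieldType) :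
  [pchar C] =i pred0 -> exists psi : K -> C, nontrivial_char psi.
Proof.
move=> pcharC; have [p p_pr pK] := finPcharP K.
have p_neq0 : p%:R != 0 :> C by have := pcharC p; rewrite !inE p_pr => /negbT.
have [z prim_z] := exists_prime_primitive_root p_pr p_neq0.
have [v2r lin_v2r bij_v2r] := pprimeChar_vectAxiom pK.
have v2rD (x y : K) : v2r (x + y) = v2r x + v2r y.
  by have := lin_v2r 1 x y; rewrite !scale1r.
have v2r0 : v2r (0 : K) = 0 by apply: (addrI (v2r 0)); rewrite -v2rD !addr0.
have [i v1i] : exists i, v2r (1 : K) 0 i != 0.
  apply/rV0Pn; apply: contra_neq (oner_neq0 K) => v10.
  exact: (bij_inj bij_v2r (etrans v10 (esym v2r0))).
exists (fun x => z ^+ (v2r x 0 i : 'F_p)); split=> [|x y|].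
- by rewrite v2r0 mxE.
- by rewrite -exprD (v2rD x y) mxE /= [X in (_ %% X)%N]Fp_cast // prim_expr_mod.
exists 1; apply: contra v1i; rewrite -(prim_order_dvd prim_z) => p_dvd.
have lt_p (t : 'F_p) : (t < p)%N by rewrite -[X in (_ < X)%N](Fp_cast p_pr) ltn_ord.
by move: p_dvd; rewrite /dvdn modn_small ?lt_p.
Qed.

Section OddField.
Variable K : finFieldType.
Hypothesis oddK : odd #|K|.

Lemma two_neq0 : (2 : K) != 0.
Proof.
apply/negP => two0; have two_char : 2%N \in [pchar K] by rewrite inE.
move: oddK (finNzRing_gt1 K); rewrite (card_pprimeChar two_char).
by case: (logn _ _) => // n; rewrite expnS oddM.
Qed.

Lemma four_neq0 : (4 : K) != 0.
Proof. by rewrite (natrM K 2 2) mulf_neq0 ?two_neq0. Qed.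

Lemma card_sqrt_le2 (y : K) : (#|[set x : K | x ^+ 2 == y]| <= 2)%N.
Proof.
have [->|[z]] := set_0Vmem [set x : K | x ^+ 2 == y]; first by rewrite cards0.
rewrite inE => /eqP <-; apply: (@leq_trans #|[set z; - z]|).
  by apply: subset_leq_card; apply/subsetP => x; rewrite !inE eqf_sqr.
by rewrite cards2; case: (_ != _).
Qed.

(* More than half of the elements of [K] are squares, so the squares meet their
   reflection in [s]. *)
Lemma sum_two_squares (s : K) : exists u v : K, u ^+ 2 + v ^+ 2 = s.
Proof.
pose sqs := [set x ^+ 2 | x : K]; pose refl := [set s - y | y in sqs].
have card_sqs : (#|K| < 2 * #|sqs|)%N.
  rewrite ltn_neqAle; apply/andP; split.
    by apply: contraTneq oddK => ->; rewrite oddM.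
  rewrite -[#|K|]sum1_card (partition_big (fun x : K => x ^+ 2) [in sqs]) /=.
    rewrite mulnC -sum_nat_const; apply: leq_sum => y _.
    by rewrite sum1dep_card card_sqrt_le2.
  by move=> x _; apply: imset_f.
have /set0Pn[y] : sqs :&: refl != set0.
  rewrite -card_gt0 -(ltn_add2l #|sqs :|: refl|) cardsUI addn0.
  rewrite [#|refl|]card_imset => [|x y /addrI/oppr_inj //]; rewrite addnn -mul2n.
  by apply: leq_ltn_trans card_sqs; apply: max_card.
rewrite inE => /andP[/imsetP[u _ ->] /imsetP[_ /imsetP[v _ ->] /eqP]].
by rewrite eq_sym subr_eq => /eqP ->; exists u, v.
Qed.

End OddField.

Section GaussSum.
Variables (R : rcfType) (K : finFieldType) (psi : K -> R[i]).
Hypotheses (psiP : nontrivial_char psi) (oddK : odd #|K|).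

Definition gauss (s : K) : R[i] := \sum_x psi (s * x ^+ 2).

Lemma gauss_complete_square (s m : K) : s != 0 ->
  \sum_x psi (s * x ^+ 2 + m * x) = gauss s * psi (- (m ^+ 2 / (4 * s))).
Proof.
move=> s0; rewrite (reindex_inj (addIr (- (m / (2 * s))))) /gauss mulr_suml.
apply: eq_bigr => x _; rewrite -(charD psiP); congr psi; field.
by rewrite s0 two_neq0 ?four_neq0.
Qed.

Lemma normc_gauss (s : K) : s != 0 -> normc (gauss s) ^+ 2 = #|K|%:R.
Proof.
move=> s0; apply: (@complexI R); rewrite sqr_normcC rmorph_nat.
have -> : gauss s * conjc (gauss s) =
    \sum_y \sum_h psi (s * h ^+ 2) * psi ((2 * s * h) * y).
  rewrite rmorph_sum mulrC mulr_suml; apply: eq_bigr => y _.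
  rewrite /= conjc_char // {1}/gauss mulr_sumr (reindex_inj (addIr y)).
  by apply: eq_bigr => h _; rewrite -!(charD psiP); congr psi; ring.
rewrite exchange_big /= (bigD1 0) //= [X in _ + X]big1 ?addr0 => [|h h0].
  by rewrite -mulr_sumr sum_char_mul // expr0n !mulr0 (char0 psiP) mul1r eqxx.
rewrite -mulr_sumr sum_char_mul // ifN ?mulr0 // mulf_neq0 // mulf_neq0 //.
exact: two_neq0.
Qed.

(* Multiplication by [u + v * i] multiplies the norm form [x ^+ 2 + y ^+ 2] by
   [s = u ^+ 2 + v ^+ 2]. *)
Lemma gauss_sqr (s : K) : s != 0 -> gauss s ^+ 2 = gauss 1 ^+ 2.
Proof.
move=> s0; have [u [v uv]] := sum_two_squares oddK s.
have sqrE c : gauss c ^+ 2 = \sum_(p : K * K) psi (c * (p.1 ^+ 2 + p.2 ^+ 2)).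
  rewrite -(pair_bigA _ (fun x y => psi (c * (x ^+ 2 + y ^+ 2)))) expr2 mulr_suml.
  apply: eq_bigr => x _; rewrite mulr_sumr; apply: eq_bigr => y _.
  by rewrite mulrDr (charD psiP).
pose rot (p : K * K) := (u * p.1 - v * p.2, v * p.1 + u * p.2).
have rot_inj : injective rot.
  have rotK p : (u * (rot p).1 + v * (rot p).2, u * (rot p).2 - v * (rot p).1) =
      (s * p.1, s * p.2) by rewrite -uv; congr (_, _); rewrite /=; ring.
  move=> p p' eq_rot; have := rotK p; rewrite eq_rot rotK => -[].
  by case: p p' {eq_rot} => x y [x' y'] /= /(mulfI s0)-> /(mulfI s0)->.
rewrite !sqrE [RHS](reindex_inj rot_inj); apply: eq_bigr => p _.
by rewrite -uv; congr psi; rewrite /=; ring.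
Qed.

Lemma normc_gaussX d u : u != 0 -> normc (gauss u ^+ d) ^+ 2 = #|K|%:R ^+ d.
Proof. by move=> u0; rewrite normcX exprAC normc_gauss. Qed.

Lemma gaussX_even d u : ~~ odd d -> u != 0 -> gauss u ^+ d = gauss 1 ^+ d.
Proof. by move=> d_even u0; rewrite -[d]even_halfK // -mul2n !exprM gauss_sqr. Qed.

End GaussSum.

Lemma parseval (R : rcfType) (A B : finType) (e : A -> B -> R[i]) (N : nat) :
    (forall b b', \sum_a e a b * conjc (e a b') = if b == b' then N%:R else 0) ->
  forall w : B -> R[i],
  \sum_a normc (\sum_b w b * e a b) ^+ 2 = N%:R * \sum_b normc (w b) ^+ 2.
Proof.
move=> orth w; apply: (@complexI R); rewrite rmorphM rmorph_nat !rmorph_sum /=.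
transitivity (\sum_a \sum_b \sum_b' w b * conjc (w b') * (e a b * conjc (e a b'))).
  apply: eq_bigr => a _; rewrite sqr_normcC rmorph_sum mulr_suml; apply: eq_bigr => b _.
  by rewrite mulr_sumr; apply: eq_bigr => b' _ /=; rewrite rmorphM /= mulrACA.
rewrite exchange_big mulr_sumr; apply: eq_bigr => b _.
rewrite exchange_big (bigD1 b) //=.
rewrite -mulr_sumr orth eqxx big1 ?addr0 => [|b' bb'];
  first by rewrite sqr_normcC mulrC.
by rewrite -mulr_sumr orth eq_sym (negPf bb') mulr0.
Qed.

Section CauchySchwarz.
Variables (R : realFieldType) (I : finType) (P : pred I).
Implicit Types x y : I -> R.

Lemma cauchy_schwarz_sum x y :
  (\sum_(i | P i) x i * y i) ^+ 2 <=
    (\sum_(i | P i) x i ^+ 2) * \sum_(i | P i) y i ^+ 2.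
Proof.
rewrite -subr_ge0 -(pmulr_rge0 _ (ltr0Sn R 1)).
set X := \sum_(i | P i) x i ^+ 2; set Y := \sum_(i | P i) y i ^+ 2.
suff -> : 2 * (X * Y - (\sum_(i | P i) x i * y i) ^+ 2)
    = \sum_(i | P i) \sum_(j | P j) (x i * y j - x j * y i) ^+ 2.
  by apply: sumr_ge0 => i _; apply: sumr_ge0 => j _; apply: sqr_ge0.
transitivity (\sum_(i | P i) (x i ^+ 2 * Y + y i ^+ 2 * X
    - 2 * (x i * y i * \sum_(j | P j) x j * y j))).
  by rewrite sumrB big_split /= -!mulr_suml -mulr_sumr -mulr_suml /X /Y; ring.
apply: eq_bigr => i _; rewrite !mulr_sumr -big_split -sumrB; apply: eq_bigr => j _.
by rewrite /=; ring.
Qed.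

Lemma sqr_sum_le x : (\sum_(i | P i) x i) ^+ 2 <= #|P|%:R * \sum_(i | P i) x i ^+ 2.
Proof.
have := cauchy_schwarz_sum (fun=> 1) x.
under eq_bigr do rewrite mul1r.
by under [in leRHS]eq_bigr do rewrite expr1n; rewrite sumr_const.
Qed.

Lemma sum_exp4_le x :
  (\sum_(i | P i) x i) ^+ 4 <= #|P|%:R ^+ 3 * \sum_(i | P i) x i ^+ 4.
Proof.
rewrite (exprM _ 2 2).
apply: (@le_trans _ _ ((#|P|%:R * \sum_(i | P i) x i ^+ 2) ^+ 2)).
  rewrite lerXn2r ?nnegrE ?sqr_ge0 ?sqr_sum_le ?mulr_ge0 ?sumr_ge0 // => i _.
  exact: sqr_ge0.
rewrite exprMn [#|P|%:R ^+ 3]exprSr -mulrA ler_wpM2l ?sqr_ge0 //.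
apply: le_trans (sqr_sum_le (fun i => x i ^+ 2)) _.
by under eq_bigr do rewrite -exprM.
Qed.

End CauchySchwarz.

Section DotProduct.
Variables (K : finFieldType) (d : nat).
Implicit Types m x y z : 'rV[K]_d.

Definition dotv x y : K := \sum_i x 0 i * y 0 i.

Lemma dotvC x y : dotv x y = dotv y x.
Proof. by apply: eq_bigr => i _; rewrite mulrC. Qed.

Lemma dotvDr m x y : dotv m (x + y) = dotv m x + dotv m y.
Proof. by rewrite /dotv -big_split; apply: eq_bigr => i _; rewrite mxE mulrDr. Qed.

Lemma dotvDl m x y : dotv (x + y) m = dotv x m + dotv y m.
Proof. by rewrite dotvC dotvDr !(dotvC m). Qed.

Lemma dotvNr m x : dotv m (- x) = - dotv m x.
Proof. by rewrite /dotv -sumrN; apply: eq_bigr => i _; rewrite mxE mulrN. Qed.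

Lemma dotv0l x : dotv 0 x = 0.
Proof. by rewrite /dotv big1 // => i _; rewrite mxE mul0r. Qed.

Lemma dotv0r m : dotv m 0 = 0.
Proof. by rewrite dotvC dotv0l. Qed.

Lemma dotv_delta c i z : dotv (c *: delta_mx 0 i) z = c * z 0 i.
Proof.
rewrite /dotv (bigD1 i) //= !mxE !eqxx mulr1 big1 ?addr0 // => j /negPf ji.
by rewrite !mxE ji andbF mulr0 mul0r.
Qed.

End DotProduct.

Lemma sum_rV_prod (T : finType) (C : comNzRingType) d (F : 'I_d -> T -> C) :
  \sum_(m : 'rV[T]_d) \prod_i F i (m 0 i) = \prod_i \sum_x F i x.
Proof.
rewrite bigA_distr_bigA /= (reindex (fun f : {ffun 'I_d -> T} => \row_i f i)) /=.
  by apply: eq_bigr => f _; apply: eq_bigr => i _; rewrite mxE.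
exists (fun m : 'rV_d => [ffun i => m 0 i]) => [f _|m _].
  by apply/ffunP => i; rewrite ffunE mxE.
by apply/rowP => i; rewrite mxE ffunE.
Qed.

Section VectorFourier.
Variables (R : rcfType) (K : finFieldType) (psi : K -> R[i]).
Hypotheses (psiP : nontrivial_char psi) (oddK : odd #|K|).
Variable d : nat.
Implicit Types m x y z : 'rV[K]_d.

Lemma nontrivial_char_dotv z : z != 0 -> nontrivial_char (fun m => psi (dotv m z)).
Proof.
move=> /rV0Pn[i zi]; split=> [|x y|]; first by rewrite dotv0l (char0 psiP).
  by rewrite dotvDl (charD psiP).
have [y psiy] := char_neq1 psiP.
by exists ((y / z 0 i) *: delta_mx 0 i); rewrite dotv_delta divfK.
Qed.

Lemma sum_char_dotv z : \sum_m psi (dotv m z) = if z == 0 then #|K|%:R ^+ d else 0.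
Proof.
case: eqP => [->|/eqP z0]; last exact: sum_nontrivial_char (nontrivial_char_dotv z0).
under eq_bigr do rewrite dotv0r (char0 psiP).
by rewrite sumr_const card_mx mul1n natrX.
Qed.

Lemma sum_char_sqnorm (u : K) z : u != 0 ->
  \sum_m psi (u * sqnorm m + dotv m z) =
    gauss psi u ^+ d * psi (- (sqnorm z / (4 * u))).
Proof.
move=> u0; have psi_sum := big_morph psi (charD psiP) (char0 psiP).
under eq_bigr => m _ do rewrite mulr_sumr -big_split psi_sum.
rewrite (sum_rV_prod (fun i (x : K) => psi (u * x ^+ 2 + x * z 0 i))) /=.
under eq_bigr => i _.
  under eq_bigr => x _ do rewrite [x * _]mulrC.
  rewrite gauss_complete_square //.
  over.
by rewrite big_split /= prodr_const card_ord -psi_sum sumrN mulr_suml.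
Qed.

Lemma orth_dotv x y :
  \sum_m psi (dotv m x) * conjc (psi (dotv m y)) = if x == y then (#|K| ^ d)%:R else 0.
Proof.
rewrite -subr_eq0 natrX -sum_char_dotv; apply: eq_bigr => m _.
by rewrite conjc_char // -(charD psiP) dotvDr dotvNr.
Qed.

Lemma orth_mul (x y : K) :
  \sum_m psi (m * x) * conjc (psi (m * y)) = if x == y then #|K|%:R else 0.
Proof.
rewrite -subr_eq0 -(sum_char_mul psiP); apply: eq_bigr => m _.
by rewrite conjc_char // -(charD psiP) -mulrN -mulrDr mulrC.
Qed.

Definition fourier (E : {set 'rV[K]_d}) m : R[i] := \sum_(x in E) psi (dotv m x).

Lemma fourier_parseval E : \sum_m normc (fourier E m) ^+ 2 = #|K|%:R ^+ d * #|E|%:R.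
Proof.
rewrite -natrX; transitivity (\sum_m normc (\sum_x (x \in E)%:R * psi (dotv m x)) ^+ 2).
  apply: eq_bigr => m _; congr (normc _ ^+ 2); rewrite /fourier big_mkcond.
  by apply: eq_bigr => x _; case: (x \in E); rewrite ?mul1r ?mul0r.
rewrite (parseval orth_dotv); congr (_ * _).
rewrite -sum1_card natr_sum [RHS]big_mkcond; apply: eq_bigr => x _.
by rewrite normc_nat; case: (x \in E); rewrite ?expr1n ?expr0n.
Qed.

Lemma fourier0 E : fourier E 0 = #|E|%:R.
Proof.
by rewrite -sum1_card natr_sum; apply: eq_bigr => x _; rewrite dotv0l (char0 psiP).
Qed.

Lemma fourier_mul_conj E F m :
  fourier E m * conjc (fourier F m) = \sum_(x in E) \sum_(y in F) psi (dotv m (x - y)).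
Proof.
rewrite /fourier mulr_suml; apply: eq_bigr => x _; rewrite rmorph_sum mulr_sumr.
by apply: eq_bigr => y _; rewrite /= conjc_char // -(charD psiP) dotvDr dotvNr.
Qed.

End VectorFourier.

(** * Fourier mass on spheres *)

Definition sphere (K : finFieldType) (d : nat) (r : K) : {set 'rV[K]_d} :=
  [set m | sqnorm m == r].

Section FourierMass.
Variables (R : rcfType) (K : finFieldType) (psi : K -> R[i]).
Hypothesis psiP : nontrivial_char psi.
Variable d : nat.
Implicit Types (E S : {set 'rV[K]_d}) (m x y z k a : 'rV[K]_d).
Let q : R := #|K|%:R.

Definition fourier_mass E S : R := \sum_(m in S) normc (fourier psi E m) ^+ 2.

Lemma fourier_mass_ge0 E S : 0 <= fourier_mass E S.
Proof. by apply: sumr_ge0 => m _; apply: sqr_ge0. Qed.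

Lemma sum_fourier_mass_sphere E : \sum_r fourier_mass E (sphere d r) = q ^+ d * #|E|%:R.
Proof.
rewrite -(fourier_parseval psiP) (partition_big (@sqnorm K d) xpredT) //=.
by apply: eq_bigr => r _; apply: eq_bigl => m; rewrite inE.
Qed.

Lemma fourier_mass_le E S (A B : R) :
    (forall z, normc (fourier psi S z) <= (z == 0)%:R * A + B) ->
  fourier_mass E S <= A * #|E|%:R + B * #|E|%:R ^+ 2.
Proof.
move=> fourier_S.
have massE : ((fourier_mass E S)%:C)%C =
    \sum_(x in E) \sum_(y in E) fourier psi S (x - y).
  rewrite rmorph_sum /=; under eq_bigr => m _ do rewrite sqr_normcC fourier_mul_conj //.
  rewrite exchange_big; apply: eq_bigr => x _.
  rewrite exchange_big; apply: eq_bigr => y _.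
  by apply: eq_bigr => m _; rewrite dotvC.
rewrite -[leLHS]ger0_norm ?fourier_mass_ge0 // -normc_real massE.
apply: le_trans (le_normc_sum _ _ _) _.
apply: (@le_trans _ _ (\sum_(x in E) \sum_(y in E) ((x - y == 0)%:R * A + B))).
  apply: ler_sum => x _; apply: le_trans (le_normc_sum _ _ _) _.
  by apply: ler_sum => y _; apply: fourier_S.
rewrite (eq_bigr (fun=> A + B *+ #|E|)) => [|x xE].
  by rewrite sumr_const -[_ *+ #|E|]mulr_natr -[B *+ _]mulr_natr; lra.
rewrite big_split /= sumr_const (bigD1 x) //= subrr eqxx mul1r big1 ?addr0 // => y.
by case/andP=> _ /negPf yx; rewrite subr_eq0 eq_sym yx mul0r.
Qed.

Section FourthMoment.
Variables (S : {set 'rV[K]_d}) (N : nat).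
Hypothesis card_meet : forall k, k != 0 -> (#|[set a in S | (k - a)%R \in S]| <= N)%N.

Section Extension.
Variable w : 'rV[K]_d -> R[i].
Let energy : R := \sum_(m in S) normc (w m) ^+ 2.

Definition fourier_ext x : R[i] := \sum_(m in S) w m * psi (dotv x m).
Definition self_conv k : R[i] := \sum_(a | (a \in S) && (k - a \in S)) w a * w (k - a).

Lemma fourier_ext_sqr x : fourier_ext x ^+ 2 = \sum_k self_conv k * psi (dotv x k).
Proof.
rewrite expr2 {1}/fourier_ext mulr_suml.
transitivity (\sum_(a in S) \sum_k (if k - a \in S then
    w a * w (k - a) * psi (dotv x k) else 0)).
  apply: eq_bigr => a _; rewrite mulr_sumr -big_mkcond [RHS](reindex_inj (addrI a)) /=.
  by apply: eq_big => b; rewrite addrAC subrr add0r // mulrACA -(charD psiP) -dotvDr.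
rewrite exchange_big; apply: eq_bigr => k _.
by rewrite mulr_suml big_mkcondr.
Qed.

Lemma normc_self_conv0_le : normc (self_conv 0) ^+ 2 <= energy ^+ 2.
Proof.
apply: (@le_trans _ _
    ((\sum_(a | (a \in S) && (0 - a \in S)) normc (w a) * normc (w (0 - a))) ^+ 2)).
  rewrite lerXn2r ?nnegrE ?normc_ge0 //.
    by apply: sumr_ge0 => a _; rewrite mulr_ge0 ?normc_ge0.
  by apply: le_trans (le_normc_sum _ _ _) _; apply: ler_sum => a _; rewrite normcM.
apply: le_trans (cauchy_schwarz_sum _ _ _) _; rewrite expr2.
apply: ler_pM; do ?by apply: sumr_ge0 => a _; apply: sqr_ge0.
  by rewrite big_mkcondr; apply: ler_sum => a _; case: ifP; rewrite // sqr_ge0.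
rewrite /energy [leRHS](reindex_inj oppr_inj) /=.
rewrite (eq_bigl (fun a => (- a \in S) && (a \in S))) => [|a];
  last by rewrite sub0r andbC.
rewrite big_mkcondr; apply: ler_sum => a _; rewrite sub0r.
by case: ifP; rewrite // sqr_ge0.
Qed.

Lemma normc_self_conv_le k : k != 0 -> normc (self_conv k) ^+ 2 <=
  N%:R * \sum_(a | (a \in S) && (k - a \in S))
      normc (w a) ^+ 2 * normc (w (k - a)) ^+ 2.
Proof.
move=> k0; apply: (@le_trans _ _
    ((\sum_(a | (a \in S) && (k - a \in S)) normc (w a * w (k - a))) ^+ 2)).
  rewrite lerXn2r ?nnegrE ?normc_ge0 ?le_normc_sum //.
  by apply: sumr_ge0 => a _; apply: normc_ge0.
apply: le_trans (sqr_sum_le _ _) _; under eq_bigr do rewrite normcM exprMn.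
apply: ler_wpM2r; first by apply: sumr_ge0 => a _; rewrite mulr_ge0 ?sqr_ge0.
by rewrite ler_nat; apply: leq_trans (card_meet k0); rewrite cardsE.
Qed.

Lemma sum_self_conv_le : \sum_k normc (self_conv k) ^+ 2 <= N.+1%:R * energy ^+ 2.
Proof.
pose pair_mass k :=
  \sum_(a | (a \in S) && (k - a \in S)) normc (w a) ^+ 2 * normc (w (k - a)) ^+ 2.
have sum_pair_mass : \sum_k pair_mass k = energy ^+ 2.
  under eq_bigr => k _ do rewrite /pair_mass big_mkcondr.
  rewrite exchange_big expr2 {1}/energy mulr_suml; apply: eq_bigr => a _ /=.
  rewrite mulr_sumr -big_mkcond (reindex_inj (addrI a)) /=.
  by apply: eq_big => b; rewrite addrAC subrr add0r.
rewrite (bigD1 0) //= -natr1 mulrDl mul1r [leRHS]addrC lerD ?normc_self_conv0_le //.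
apply: (@le_trans _ _ (\sum_(k | k != 0) N%:R * pair_mass k)).
  by apply: ler_sum => k; apply: normc_self_conv_le.
rewrite -mulr_sumr ler_wpM2l // -sum_pair_mass [leRHS](bigD1 0) //= lerDr.
by apply: sumr_ge0 => a _; rewrite mulr_ge0 ?sqr_ge0.
Qed.

Lemma fourier_ext_fourth_moment :
  \sum_x normc (fourier_ext x) ^+ 4 <= q ^+ d * (N.+1%:R * energy ^+ 2).
Proof.
apply: le_trans (ler_wpM2l (exprn_ge0 d (ler0n R _)) sum_self_conv_le).
have := parseval (orth_dotv psiP (d := d)) self_conv; rewrite natrX => <-.
apply: ler_sum => x _; rewrite (exprM _ 2 2) -normcX fourier_ext_sqr.
by rewrite -[leRHS]normcX -normcX.
Qed.

End Extension.

Lemma fourier_mass_sqr_le E : fourier_mass E S ^+ 2 <= N.+1%:R * q ^+ d * #|E|%:R ^+ 3.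
Proof.
pose ext := fourier_ext (fun m => conjc (fourier psi E m)).
set M := fourier_mass E S; have M_ge0 : 0 <= M := fourier_mass_ge0 E S.
have M_le_ext : M <= \sum_(x in E) normc (ext x).
  have massE : (M%:C)%C = \sum_(x in E) ext x.
    rewrite rmorph_sum exchange_big /=; apply: eq_bigr => m _.
    rewrite sqr_normcC mulrC {2}/fourier mulr_sumr.
    by apply: eq_bigr => x _; rewrite dotvC.
  by rewrite -[M]ger0_norm // -normc_real massE le_normc_sum.
have M4 : M ^+ 4 <= #|E|%:R ^+ 3 * (q ^+ d * (N.+1%:R * M ^+ 2)).
  apply: (@le_trans _ _ ((\sum_(x in E) normc (ext x)) ^+ 4)).
    rewrite lerXn2r ?nnegrE //.
    by apply: sumr_ge0 => x _; apply: normc_ge0.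
  apply: le_trans (sum_exp4_le _ _) _; rewrite ler_wpM2l ?exprn_ge0 //.
  have := fourier_ext_fourth_moment (fun m => conjc (fourier psi E m)).
  under [X in _ * X ^+ 2]eq_bigr do rewrite normc_conj.
  apply: le_trans; rewrite [leRHS](bigID [in E]) /= lerDl.
  by apply: sumr_ge0 => x _; rewrite exprn_ge0 ?normc_ge0.
have [->|M_neq0] := eqVneq M 0; first by rewrite expr0n !mulr_ge0 ?exprn_ge0.
have M2_gt0 : 0 < M ^+ 2 by rewrite exprn_gt0 // lt_def M_neq0.
by rewrite -(ler_pM2r M2_gt0) -exprD; apply: le_trans M4 _; lra.
Qed.

End FourthMoment.

End FourierMass.

Section Circles.
Variable K : finFieldType.
Hypothesis oddK : odd #|K|.
Implicit Types (a b k x y : 'rV[K]_2) (r t : K).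

Lemma row2P x y : x 0 0 = y 0 0 -> x 0 1 = y 0 1 -> x = y.
Proof.
move=> xy0 xy1; apply/rowP => -[[|[|//]] lt_i].
  by rewrite (_ : Ordinal _ = 0) //; apply: val_inj.
by rewrite (_ : Ordinal _ = 1) //; apply: val_inj.
Qed.

Lemma sqnorm2E x : sqnorm x = x 0 0 ^+ 2 + x 0 1 ^+ 2.
Proof.
by rewrite /sqnorm !big_ord_recl big_ord0 addr0; congr (_ + x 0 _ ^+ 2); apply: val_inj.
Qed.

Lemma sqnorm2_eq0 x : (forall z : K, z ^+ 2 != -1) -> (sqnorm x == 0) = (x == 0).
Proof.
move=> nonsquare; apply/eqP/eqP => [|->]; last by rewrite sqnorm2E !mxE expr0n addr0.
rewrite sqnorm2E => /eqP; rewrite addr_eq0 => /eqP x2.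
have x1 : x 0 1 = 0.
  apply: contraTeq isT => x1; have := nonsquare (x 0 0 / x 0 1).
  by rewrite expr_div_n x2 mulNr divff ?eqxx // expf_neq0.
by apply: row2P; apply/eqP; rewrite mxE ?x1 // -sqrf_eq0 x2 x1 expr0n oppr0.
Qed.

Definition rot90 x : 'rV[K]_2 := \row_i (if i == 0 then - x 0 1 else x 0 0).

Lemma orth_rot90 k b : k != 0 -> k 0 0 * b 0 0 + k 0 1 * b 0 1 = 0 ->
  exists t, b = t *: rot90 k.
Proof.
move=> k0 kb; have [k00|k00] := eqVneq (k 0 0) 0.
  have k01 : k 0 1 != 0.
    by apply: contraNneq k0 => k01; apply/eqP/row2P; rewrite mxE.
  have b1 : b 0 1 = 0.
    by apply: (mulfI k01); rewrite mulr0 -kb k00 mul0r add0r.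
  exists (- (b 0 0 / k 0 1)); apply: row2P; rewrite !mxE /=; last by rewrite k00 mulr0.
  by field.
have kb0 : k 0 0 * b 0 0 = - (k 0 1 * b 0 1) by apply/eqP; rewrite -addr_eq0 kb.
exists (b 0 1 / k 0 0); apply: row2P; rewrite !mxE /=; last by field.
by apply: (mulfI k00); rewrite kb0; field.
Qed.

(* For [a] in both circles [a - (k - a)] is orthogonal to [k], hence equal to
   [t *: rot90 k], and the parallelogram law [4 * r = (t ^+ 2 + 1) * sqnorm k]
   leaves two values for [t]. *)
Lemma card_sphere_meet k r : k != 0 -> r != 0 ->
  (#|[set a in sphere 2 r | (k - a)%R \in sphere 2 r]| <= 2)%N.
Proof.
move=> k0 r0; pose half t := 2^-1 *: (k + t *: rot90 k).
apply: leq_trans (card_sqrt_le2 (4 * r / sqnorm k - 1)).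
apply: leq_trans (leq_imset_card half _); apply: subset_leq_card; apply/subsetP => a.
rewrite !inE => /andP[/eqP a_r /eqP ka_r].
have [|t abt] := @orth_rot90 k (a - (k - a)) k0.
  transitivity (sqnorm a - sqnorm (k - a)); first by rewrite !sqnorm2E !mxE; ring.
  by rewrite a_r ka_r subrr.
have aE : a = half t.
  rewrite /half -abt; apply/rowP => i; rewrite !mxE; field.
  exact: two_neq0.
have parallelogram : (t ^+ 2 + 1) * sqnorm k = 4 * r.
  have -> : (t ^+ 2 + 1) * sqnorm k = sqnorm (t *: rot90 k) + sqnorm k.
    by rewrite !sqnorm2E !mxE /=; ring.
  rewrite -abt (_ : 4 * r = 2 * (r + r)); last by ring.
  by rewrite -{1}a_r -ka_r !sqnorm2E !mxE; ring.
have k_neq0 : sqnorm k != 0.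
  apply: contraNneq r0 => k_eq0; move/esym/eqP: parallelogram.
  by rewrite k_eq0 mulr0 mulf_eq0 (negPf (four_neq0 oddK)).
by apply/imsetP; exists t; rewrite // inE -parallelogram mulfK // addrK.
Qed.

End Circles.

Section SphereMass.
Variables (R : rcfType) (K : finFieldType) (psi : K -> R[i]).
Hypotheses (psiP : nontrivial_char psi) (oddK : odd #|K|).
Let q : R := #|K|%:R.
Let q_gt0 : 0 < q. Proof. exact: natr_card_gt0. Qed.

Lemma fourier_mass_circle_sqr_le (E : {set 'rV[K]_2}) (r : K) : r != 0 ->
  fourier_mass psi E (sphere 2 r) ^+ 2 <= 3 * q ^+ 2 * #|E|%:R ^+ 3.
Proof.
by move=> r0; apply: (fourier_mass_sqr_le psiP) => k k0; apply: card_sphere_meet.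
Qed.

Section EvenDimension.
Variable d : nat.
Hypothesis d_even : ~~ odd d.
Implicit Types (E : {set 'rV[K]_d}) (z : 'rV[K]_d) (r : K).

Lemma fourier_sphere r z : #|K|%:R * fourier psi (sphere d r) z =
  (z == 0)%:R * #|K|%:R ^+ d +
    gauss psi 1 ^+ d * kloosterman psi (- r) (- (sqnorm z / 4)).
Proof.
transitivity (\sum_s psi (- (s * r)) * \sum_m psi (s * sqnorm m + dotv m z)).
  under [RHS]eq_bigr do rewrite mulr_sumr.
  rewrite exchange_big mulr_sumr big_mkcond; apply: eq_bigr => m _ /=.
  under [RHS]eq_bigr => s _.
    rewrite (charD psiP) mulrA -(charD psiP) (_ : - _ + _ = (sqnorm m - r) * s);
      last by ring.
    over.
  rewrite -mulr_suml sum_char_mul // subr_eq0 inE dotvC.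
  by case: eqP; rewrite ?mul0r.
rewrite (bigD1 0) //= mul0r oppr0 (char0 psiP) mul1r; congr (_ + _).
  under eq_bigr do rewrite mul0r add0r.
  by rewrite sum_char_dotv //; case: eqP; rewrite ?mul1r ?mul0r.
rewrite /kloosterman mulr_sumr; apply: eq_bigr => s s0.
rewrite sum_char_sqnorm // gaussX_even // mulrCA -(charD psiP).
by congr (_ * psi _); rewrite mulNr [r * s]mulrC invfM mulNr !mulrA.
Qed.

Lemma normc_fourier_sphere_le r z : (0 < d)%N -> r != 0 ->
  normc (fourier psi (sphere d r) z) <=
    (z == 0)%:R * (q ^+ d / q) + 3 * Num.sqrt (q ^+ (d - 1)).
Proof.
move=> d_gt0 r0; rewrite -(ler_pM2l q_gt0).
rewrite -[X in X * _ <= _]normc_nat -normcM fourier_sphere.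
have sqrtE : Num.sqrt (q ^+ d) * Num.sqrt q = q * Num.sqrt (q ^+ (d - 1)).
  rewrite -[X in X * Num.sqrt (q ^+ (d - 1))](ger0_norm (ltW q_gt0)) -sqrtr_sqr.
  rewrite -!sqrtrM ?exprn_ge0 ?sqr_ge0 ?ltW //; congr Num.sqrt.
  by rewrite -exprSr -exprD; congr (_ ^+ _); lia.
have normc_gd : normc (gauss psi 1 ^+ d) = Num.sqrt (q ^+ d).
  rewrite -(normc_gaussX psiP oddK d (oner_neq0 K)) sqrtr_sqr ger0_norm //.
  exact: normc_ge0.
rewrite mulrDr mulrCA [q * (_ / q)]mulrC divfK ?gt_eqF // mulrCA -sqrtE mulrCA.
apply: le_trans (le_normcD _ _) _; rewrite !normcM normcX !normc_nat normc_gd lerD2l.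
by rewrite ler_wpM2l ?sqrtr_ge0 // kloosterman_bound // oppr_eq0.
Qed.

Lemma fourier_mass_sphere_even_le E r : (0 < d)%N -> r != 0 ->
  fourier_mass psi E (sphere d r) <=
    q ^+ d / q * #|E|%:R + 3 * Num.sqrt (q ^+ (d - 1)) * #|E|%:R ^+ 2.
Proof.
by move=> d_gt0 r0; apply: (fourier_mass_le psiP) => z; apply: normc_fourier_sphere_le.
Qed.

End EvenDimension.

End SphereMass.

(** * Second moment of the distance counts *)

Section DistanceCount.
Variables (K : finFieldType) (d : nat) (E G : {set 'rV[K]_d}).
Implicit Types (t : K).

Definition dist_count t : nat :=
  #|[set p : 'rV[K]_d * 'rV[K]_d |
      [&& p.1 \in E, p.2 \in G & sqnorm (p.1 - p.2) == t]]|.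

Lemma sum_dist_count : (\sum_t dist_count t = #|E| * #|G|)%N.
Proof.
rewrite -cardsX -sum1_card (partition_big (fun p => sqnorm (p.1 - p.2)) xpredT) //=.
apply: eq_bigr => t _; rewrite /dist_count -sum1dep_card; apply: eq_bigl => p.
by rewrite inE andbA.
Qed.

Lemma dist_count_out t : t \notin dist_set E G -> dist_count t = 0%N.
Proof.
move=> tD; apply/eqP; rewrite cards_eq0; apply/eqP/setP => p; rewrite !inE.
by apply: contraNF tD => /and3P[pE pG /eqP <-]; apply: imset2_f.
Qed.

Lemma sqr_sum_dist_count_le (R : realFieldType) (P : pred K) :
  (\sum_(t | P t) (dist_count t)%:R) ^+ 2 <=
    #|dist_set E G|%:R * \sum_(t | P t) (dist_count t)%:R ^+ 2 :> R.
Proof.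
have split_out (w : K -> R) : (forall t, t \notin dist_set E G -> w t = 0) ->
    \sum_(t | P t) w t = \sum_(t | P t && (t \in dist_set E G)) w t.
  move=> w0; rewrite [RHS]big_mkcondr; apply: eq_bigr => t _.
  by case: ifPn => // /w0.
rewrite !split_out => [|t /dist_count_out->|t /dist_count_out->]; rewrite ?expr0n //.
apply: le_trans (sqr_sum_le _ _) _; apply: ler_wpM2r.
  by apply: sumr_ge0 => t _; apply: sqr_ge0.
by rewrite ler_nat subset_leq_card //; apply/subsetP => t /andP[].
Qed.

End DistanceCount.

Section SecondMoment.
Variables (R : rcfType) (K : finFieldType) (psi : K -> R[i]).
Hypotheses (psiP : nontrivial_char psi) (oddK : odd #|K|).
Variables (d : nat) (E G : {set 'rV[K]_d}).
Implicit Types r s t u : K.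
Let q : R := #|K|%:R.
Let e : R := #|E|%:R.
Let f : R := #|G|%:R.
Let q_gt0 : 0 < q. Proof. exact: natr_card_gt0. Qed.
Let qd_gt0 : 0 < q ^+ d. Proof. exact: exprn_gt0. Qed.

Definition dist_char_sum s : R[i] :=
  \sum_(x in E) \sum_(y in G) psi (s * sqnorm (x - y)).
Definition sphere_corr r : R[i] :=
  \sum_(m in sphere d r) fourier psi E m * conjc (fourier psi G m).

Lemma dist_char_sumE s : dist_char_sum s = \sum_t (dist_count E G t)%:R * psi (s * t).
Proof.
rewrite /dist_char_sum pair_big /=.
rewrite (partition_big (fun p => sqnorm (p.1 - p.2)) xpredT) //=.
apply: eq_bigr => t _; rewrite (eq_bigr (fun=> psi (s * t))) => [|p /andP[_ /eqP->] //].
rewrite sumr_const mulr_natl /dist_count cardsE; congr (_ *+ _); apply: eq_card => p.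
by rewrite -!topredE /= andbA.
Qed.

Lemma dist_char_sum0 : dist_char_sum 0 = (#|E| * #|G|)%:R.
Proof.
rewrite dist_char_sumE -sum_dist_count natr_sum; apply: eq_bigr => t _.
by rewrite mul0r (char0 psiP) mulr1.
Qed.

Lemma dist_char_sum_dual u : u != 0 ->
  gauss psi u ^+ d * dist_char_sum (- (4 * u)^-1) = \sum_r sphere_corr r * psi (u * r).
Proof.
move=> u0; transitivity
  (\sum_m psi (u * sqnorm m) * (fourier psi E m * conjc (fourier psi G m))).
  under [RHS]eq_bigr => m _ do rewrite fourier_mul_conj // mulr_sumr.
  rewrite [RHS]exchange_big mulr_sumr; apply: eq_bigr => x _ /=.
  under [RHS]eq_bigr => m _ do rewrite mulr_sumr.
  rewrite [RHS]exchange_big mulr_sumr; apply: eq_bigr => y _ /=.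
  under [RHS]eq_bigr => m _ do rewrite -(charD psiP).
  by rewrite sum_char_sqnorm //; congr (_ * psi _); rewrite mulNr mulrC.
rewrite (partition_big (@sqnorm K d) xpredT) //=; apply: eq_bigr => r _.
rewrite mulr_suml; apply: eq_big => [m|m /eqP->]; first by rewrite inE.
by rewrite mulrC.
Qed.

Let inv4 u := - (4 * u)^-1.

Let inv4K : involutive inv4.
Proof.
by move=> u; rewrite /inv4 mulrN invrN opprK invfM invrK mulKf ?(four_neq0 oddK).
Qed.

Let inv4_eq0 u : (inv4 u == 0) = (u == 0).
Proof. by rewrite oppr_eq0 invr_eq0 mulf_eq0 (negPf (four_neq0 oddK)). Qed.

(* Subtracting a point mass [c] at distance zero subtracts the constant [c] from
   all exponential sums. *)
Lemma sum_shifted_dist_count_sqr_le (c : R[i]) (h : K -> R[i]) :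
    (forall u, u != 0 ->
      gauss psi u ^+ d * (dist_char_sum (- (4 * u)^-1) - c) =
        \sum_r h r * psi (u * r)) ->
  \sum_t normc ((dist_count E G t)%:R - (t == 0)%:R * c) ^+ 2 <=
    normc ((#|E| * #|G|)%:R - c) ^+ 2 / q + (\sum_r normc (h r) ^+ 2) / q ^+ d.
Proof.
move=> dual; have shiftE s :
    \sum_t ((dist_count E G t)%:R - (t == 0)%:R * c) * psi (s * t) =
    dist_char_sum s - c.
  under eq_bigr do rewrite mulrBl.
  rewrite sumrB -dist_char_sumE; congr (_ - _).
  rewrite (bigD1 0) //= eqxx mulr0 (char0 psiP).
  by rewrite mul1r mulr1 big1 ?addr0 // => t /negPf ->; rewrite !mul0r.
rewrite -(ler_pM2l q_gt0) -(parseval (orth_mul psiP)) mulrDr [q * (_ / q)]mulrC.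
rewrite divfK ?gt_eqF // (bigD1 0) //= shiftE dist_char_sum0 lerD2l mulrA.
rewrite -(parseval (orth_mul psiP)) ler_pdivlMr //.
rewrite (reindex_inj (inv_inj inv4K)) /= mulr_suml.
rewrite [leLHS](eq_bigl (fun u => u != 0)) => [|u]; last by rewrite inv4_eq0.
rewrite [leRHS](bigID (fun u => u != 0)) /= ler_wpDr ?sumr_ge0 // => [u _|].
  exact: sqr_ge0.
apply: ler_sum => u u0; rewrite shiftE -dual // normcM exprMn normc_gaussX //.
by rewrite mulrC.
Qed.

Lemma normc_sphere_corr_sqr_le r :
  normc (sphere_corr r) ^+ 2 <=
    fourier_mass psi E (sphere d r) * fourier_mass psi G (sphere d r).
Proof.
apply: le_trans (cauchy_schwarz_sum _ _ _).
rewrite lerXn2r ?nnegrE ?normc_ge0 ?sumr_ge0 // => [m _|].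
  by rewrite mulr_ge0 ?normc_ge0.
apply: le_trans (le_normc_sum _ _ _) _; apply: ler_sum => m _.
by rewrite normcM normc_conj.
Qed.

Lemma sum_sphere_corr_sqr_le (P : pred K) (M : R) : 0 <= M ->
    (forall r, P r -> fourier_mass psi E (sphere d r) <= M) ->
  \sum_(r | P r) normc (sphere_corr r) ^+ 2 <= M * (q ^+ d * f).
Proof.
move=> M_ge0 mass_le;
  rewrite -(sum_fourier_mass_sphere psiP) mulr_sumr [leRHS](bigID P) /=.
apply: ler_wpDr; first by apply: sumr_ge0 => r _; rewrite mulr_ge0 ?fourier_mass_ge0.
apply: ler_sum => r Pr; apply: le_trans (normc_sphere_corr_sqr_le r) _.
by rewrite ler_wpM2r ?fourier_mass_ge0 ?mass_le.
Qed.

Lemma sum_all_sphere_corr_sqr_le :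
  \sum_r normc (sphere_corr r) ^+ 2 <= (q ^+ d) ^+ 2 * (e * f).
Proof.
have -> : (q ^+ d) ^+ 2 * (e * f) = q ^+ d * e * (q ^+ d * f) by ring.
apply: sum_sphere_corr_sqr_le => [|r _]; first by rewrite mulr_ge0 ?exprn_ge0 ?ler0n.
rewrite -(sum_fourier_mass_sphere psiP) (bigD1 r) //= lerDl.
by apply: sumr_ge0 => r' _; apply: fourier_mass_ge0.
Qed.

Lemma sum_dist_count_sqr_corr_le : \sum_t (dist_count E G t)%:R ^+ 2 <=
  (e * f) ^+ 2 / q + (\sum_r normc (sphere_corr r) ^+ 2) / q ^+ d.
Proof.
have := @sum_shifted_dist_count_sqr_le 0 sphere_corr.
rewrite subr0 normc_nat natrM; under [leLHS]eq_bigr do rewrite mulr0 subr0 normc_nat.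
by apply=> u u0; rewrite subr0 dist_char_sum_dual.
Qed.

Lemma sum_dist_count_sqr_le :
  \sum_t (dist_count E G t)%:R ^+ 2 <= (e * f) ^+ 2 / q + q ^+ d * (e * f).
Proof.
apply: le_trans sum_dist_count_sqr_corr_le _; rewrite lerD2l ler_pdivrMr //.
by rewrite mulrAC -expr2 sum_all_sphere_corr_sqr_le.
Qed.

(* In even dimension [gauss psi u ^+ d] does not depend on [u], so the correlation
   on the isotropic cone contributes the same constant to all [dist_char_sum s] with
   [s != 0]. *)
Lemma sum_dist_count_neq0_sqr_le (M : R) : ~~ odd d ->
    (forall r, r != 0 -> fourier_mass psi E (sphere d r) <= M) ->
  \sum_(t | t != 0) (dist_count E G t)%:R ^+ 2 <=
    2 * (e * f) ^+ 2 / q + 2 * (q ^+ d / q) * (e * f) + M * f.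
Proof.
move=> d_even mass_le; set g := gauss psi 1 ^+ d.
have normc_g : normc g ^+ 2 = q ^+ d by rewrite normc_gaussX // oner_neq0.
have g0 : g != 0.
  by apply: contraTneq qd_gt0 => g0; rewrite -normc_g g0 normc0 expr0n ltxx.
pose c := sphere_corr 0 / g; pose h r := if r == 0 then 0 else sphere_corr r.
have dual u : u != 0 ->
    gauss psi u ^+ d * (dist_char_sum (- (4 * u)^-1) - c) = \sum_r h r * psi (u * r).
  move=> u0; rewrite mulrBr dist_char_sum_dual // gaussX_even // -/g mulrC divfK //.
  rewrite (bigD1 0) // [RHS](bigD1 0) //= /h eqxx mulr0 (char0 psiP) mulr1 mul0r add0r.
  by rewrite addrAC subrr add0r; apply: eq_bigr => r /negPf->.
have normc_c : normc c ^+ 2 <= q ^+ d * (e * f).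
  rewrite normcM exprMn normcV exprVn normc_g ler_pdivrMr // mulrAC -expr2.
  apply: le_trans sum_all_sphere_corr_sqr_le; rewrite (bigD1 0) //= lerDl.
  by apply: sumr_ge0 => r _; apply: sqr_ge0.
have normc_ef : normc ((#|E| * #|G|)%:R - c) ^+ 2 <=
    2 * (e * f) ^+ 2 + 2 * (q ^+ d * (e * f)).
  apply: (@le_trans _ _ ((e * f + normc c) ^+ 2)).
    rewrite lerXn2r ?nnegrE ?normc_ge0 ?addr_ge0 ?mulr_ge0 ?normc_ge0 //.
    by rewrite -natrM -normc_nat -(normcN c) le_normcD.
  by have := sqr_ge0 (e * f - normc c); nra.
have sum_h : (\sum_r normc (h r) ^+ 2) / q ^+ d <= M * f.
  rewrite ler_pdivrMr // -mulrA [f * _]mulrC (bigD1 0) //= /h eqxx normc0 expr0n add0r.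
  rewrite (eq_bigr (fun r => normc (sphere_corr r) ^+ 2)) => [|r /negPf->] //.
  apply: sum_sphere_corr_sqr_le => //.
  exact: le_trans (fourier_mass_ge0 psi E _) (mass_le 1 (oner_neq0 K)).
apply: (@le_trans _ _ (\sum_t normc ((dist_count E G t)%:R - (t == 0)%:R * c) ^+ 2)).
  rewrite [leRHS](bigD1 0) //= ler_wpDl ?sqr_ge0 //; apply: ler_sum => t /negPf->.
  by rewrite mul0r subr0 normc_nat.
apply: le_trans (sum_shifted_dist_count_sqr_le dual) _; apply: lerD sum_h.
rewrite ler_pdivrMr // mulrDl (_ : _ / q * q = 2 * (e * f) ^+ 2); last first.
  by rewrite divfK ?gt_eqF.
rewrite (_ : 2 * (q ^+ d / q) * (e * f) * q = 2 * (q ^+ d * (e * f))) //.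
by field; rewrite gt_eqF.
Qed.

End SecondMoment.

(** * Distance sets *)

Lemma min_le_of_inv_sum (R : realFieldType) (D a b u v : R) :
    0 <= D -> 0 <= u -> 0 <= v -> 0 < a -> 0 < b ->
  1 <= D * (u / a + v / b) -> Num.min a b <= (u + v) * D.
Proof.
move=> D_ge0 u_ge0 v_ge0 a_gt0 b_gt0 le_D; set m := Num.min a b.
have m_gt0 : 0 < m by rewrite lt_min a_gt0.
have ma : m / a <= 1 by rewrite ler_pdivrMr // mul1r ge_min lexx.
have mb : m / b <= 1 by rewrite ler_pdivrMr // mul1r ge_min lexx orbT.
rewrite -[m]mulr1; apply: le_trans (ler_wpM2l (ltW m_gt0) le_D) _.
have -> : m * (D * (u / a + v / b)) = (u * (m / a) + v * (m / b)) * D by ring.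
by rewrite ler_wpM2r // lerD // ler_piMr.
Qed.

Lemma natr_mul_gt0 (R : realFieldType) (m n : nat) :
  0 < m%:R * n%:R :> R -> 0 < m%:R :> R /\ 0 < n%:R :> R.
Proof. by rewrite -natrM !ltr0n muln_gt0 => /andP. Qed.

Section DistanceSets.
Variables (R : rcfType) (K : finFieldType) (psi : K -> R[i]).
Hypotheses (psiP : nontrivial_char psi) (oddK : odd #|K|).
Variables (d : nat) (E G : {set 'rV[K]_d}).
Let q : R := #|K|%:R.
Let e : R := #|E|%:R.
Let f : R := #|G|%:R.
Let D : R := #|dist_set E G|%:R.
Let q_gt0 : 0 < q. Proof. exact: natr_card_gt0. Qed.
Let D_ge0 : 0 <= D. Proof. exact: ler0n. Qed.
Let qd_gt0 : 0 < q ^+ d. Proof. exact: exprn_gt0. Qed.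
Let sum_dist_countR : \sum_t (dist_count E G t)%:R = e * f.
Proof. by rewrite -natr_sum sum_dist_count natrM. Qed.

Lemma card_dist_set_ge_moment (T : R) : 0 < e * f ->
  \sum_t (dist_count E G t)%:R ^+ 2 <= T -> 1 <= D * (T / (e * f) ^+ 2).
Proof.
move=> ef_gt0 moment; rewrite mulrA ler_pdivlMr ?exprn_gt0 // mul1r -sum_dist_countR.
exact: le_trans (sqr_sum_dist_count_le E G R xpredT) (ler_wpM2l D_ge0 moment).
Qed.

Lemma card_dist_set_large : 16 * q ^+ d <= e * f ->
  1 / 144 * Num.min q (2 * e * f / q ^+ d) <= D.
Proof.
move=> ef_ge; have ef_gt0 : 0 < e * f by have := qd_gt0; lra.
have := card_dist_set_ge_moment ef_gt0 (sum_dist_count_sqr_le psiP oddK E G).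
rewrite -/q -/e -/f.
rewrite (_ : _ / (e * f) ^+ 2 = 1 / q + 2 / (2 * e * f / q ^+ d)); last first.
  rewrite -[2 * e * f]mulrA; move: (e * f) ef_gt0 => ef ef_gt0.
  by field; rewrite !gt_eqF.
have b_gt0 : 0 < 2 * e * f / q ^+ d by rewrite divr_gt0 // -mulrA mulr_gt0.
by move/(min_le_of_inv_sum D_ge0 ler01 (ler0n R 2) q_gt0 b_gt0); have := D_ge0; lra.
Qed.

Section LargeProduct.
Hypothesis ef_ge : 16 * q ^+ d <= e * f.
Let ef_gt0 : 0 < e * f. Proof. by have := ef_ge; have := qd_gt0; lra. Qed.
Let e_gt0 : 0 < e. Proof. by have [] := natr_mul_gt0 ef_gt0. Qed.
Let f_gt0 : 0 < f. Proof. by have [] := natr_mul_gt0 ef_gt0. Qed.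

Lemma dist_count0_le : (dist_count E G 0)%:R <= 2 / 3 * (e * f).
Proof.
rewrite -(@ler_pXn2r _ 2) ?nnegrE ?mulr_ge0 ?invr_ge0 ?ler0n //.
have := sum_dist_count_sqr_le psiP oddK E G; rewrite (bigD1 0) //= -/q -/e -/f.
have : 0 <= \sum_(t | t != 0) (dist_count E G t)%:R ^+ 2 :> R.
  by apply: sumr_ge0 => t _; apply: sqr_ge0.
have : (e * f) ^+ 2 / q <= (e * f) ^+ 2 / 3.
  by rewrite ler_wpM2l ?sqr_ge0 // lef_pV2 ?posrE // ler_nat odd_card_gt2.
have : 16 * q ^+ d * (e * f) <= (e * f) * (e * f) by rewrite ler_pM2r.
rewrite -expr2; have := sqr_ge0 (e * f); lra.
Qed.

(* By [dist_count0_le] a third of the pairs are at nonzero distance, whence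
   [9 = 3 ^+ 2]. *)
Lemma card_dist_set_ge_moment_neq0 (T : R) :
  \sum_(t | t != 0) (dist_count E G t)%:R ^+ 2 <= T -> 1 <= 9 * D * (T / (e * f) ^+ 2).
Proof.
move=> moment; rewrite mulrA ler_pdivlMr ?exprn_gt0 // mul1r.
have := sum_dist_countR; rewrite (bigD1 0) //= => sumE.
have third : 1 / 3 * (e * f) <= \sum_(t | t != 0) (dist_count E G t)%:R.
  by have := dist_count0_le; lra.
have : (1 / 3 * (e * f)) ^+ 2 <= D * T.
  apply: le_trans (ler_wpM2l D_ge0 moment).
  apply: le_trans (sqr_sum_dist_count_le E G R (fun t => t != 0)).
  by rewrite lerXn2r ?nnegrE ?sumr_ge0 ?mulr_ge0 ?invr_ge0 ?ler0n.
by rewrite exprMn; lra.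
Qed.

Lemma card_dist_set_ge_mass (M : R) : ~~ odd d ->
    (forall r, r != 0 -> fourier_mass psi E (sphere d r) <= M) ->
  1 <= 9 * D * (17 / 8 / q + M / (e ^+ 2 * f)).
Proof.
move=> d_even mass_le.
have := sum_dist_count_neq0_sqr_le psiP oddK G d_even mass_le.
move/card_dist_set_ge_moment_neq0/le_trans; apply.
rewrite ler_wpM2l ?mulr_ge0 // -/q -/e -/f.
have -> : (2 * (e * f) ^+ 2 / q + 2 * (q ^+ d / q) * (e * f) + M * f) / (e * f) ^+ 2 =
    2 / q + 2 * (q ^+ d / (e * f)) / q + M / (e ^+ 2 * f).
  by field; rewrite !gt_eqF.
rewrite lerD2r -mulrDl ler_pM2r ?invr_gt0 //.
have : q ^+ d / (e * f) <= 1 / 16 by rewrite ler_pdivrMr //; have := ef_ge; lra.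
by lra.
Qed.

Section EvenDimension.
Hypotheses (d_even : ~~ odd d) (d_gt0 : (0 < d)%N).
Let w : R := Num.sqrt (q ^+ (d - 1)).
Let w_gt0 : 0 < w. Proof. by rewrite sqrtr_gt0 exprn_gt0. Qed.
Let w2 : q ^+ d = q * w ^+ 2.
Proof. by rewrite sqr_sqrtr ?exprn_ge0 ?ltW // -exprS subn1 prednK. Qed.

Let mass_le r : r != 0 ->
  fourier_mass psi E (sphere d r) <= w ^+ 2 * e + 3 * w * e ^+ 2.
Proof.
move=> r0; have := fourier_mass_sphere_even_le psiP oddK d_even E d_gt0 r0.
by rewrite -/q w2 [q * _]mulrC mulfK ?gt_eqF.
Qed.

Lemma card_dist_set_small : e < w -> q / 144 <= D.
Proof.
move=> lt_ew; have /(card_dist_set_ge_mass d_even) : forall r, r != 0 ->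
    fourier_mass psi E (sphere d r) <= 4 * w ^+ 2 * e.
  move=> r /mass_le/le_trans; apply.
  have : e * (w * e) <= e * (w * w) by rewrite ler_pM2l // ler_pM2l // ltW.
  by rewrite !expr2; lra.
have -> : 4 * w ^+ 2 * e / (e ^+ 2 * f) = 4 * (q ^+ d / (e * f)) / q.
  by rewrite w2; field; rewrite !gt_eqF.
rewrite -mulrDl [9 * D * _]mulrA ler_pdivlMr // mul1r.
have : D * (q ^+ d / (e * f)) <= D * (1 / 16).
  by apply: ler_wpM2l => //; rewrite ler_pdivrMr //; have := ef_ge; lra.
by have := D_ge0; lra.
Qed.

Lemma card_dist_set_medium : w <= e -> 1 / 144 * Num.min q (f / (2 * w)) <= D.
Proof.
move=> le_we; have /(card_dist_set_ge_mass d_even) : forall r, r != 0 ->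
    fourier_mass psi E (sphere d r) <= 4 * w * e ^+ 2.
  move=> r /mass_le/le_trans; apply.
  have : w * (w * e) <= w * (e * e) by rewrite ler_pM2l // ler_pM2r.
  by rewrite !expr2; lra.
have -> : 4 * w * e ^+ 2 / (e ^+ 2 * f) = 2 / (f / (2 * w)).
  by field; rewrite !gt_eqF.
have D9_ge0 : 0 <= 9 * D by rewrite mulr_ge0.
have b_gt0 : 0 < f / (2 * w) by rewrite divr_gt0 ?mulr_gt0.
have c_ge0 : 0 <= 17 / 8 :> R by lra.
by move/(min_le_of_inv_sum D9_ge0 c_ge0 (ler0n R 2) q_gt0 b_gt0); have := D_ge0; lra.
Qed.

End EvenDimension.

End LargeProduct.

End DistanceSets.

Section PlaneDistanceSets.
Variables (R : rcfType) (K : finFieldType) (psi : K -> R[i]).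
Hypotheses (psiP : nontrivial_char psi) (oddK : odd #|K|).
Variables E G : {set 'rV[K]_2}.
Let q : R := #|K|%:R.
Let e : R := #|E|%:R.
Let f : R := #|G|%:R.
Let D : R := #|dist_set E G|%:R.
Let sqrt_e : R := Num.sqrt e.
Let sqrt3 : R := Num.sqrt 3.
Let q_gt0 : 0 < q. Proof. exact: natr_card_gt0. Qed.
Let D_ge0 : 0 <= D. Proof. exact: ler0n. Qed.
Let sqr_sqrt_e : sqrt_e ^+ 2 = e. Proof. by rewrite sqr_sqrtr. Qed.
Let sqrt3_gt0 : 0 < sqrt3. Proof. by rewrite sqrtr_gt0. Qed.

Lemma fourier_mass_circle_le (r : K) : r != 0 ->
  fourier_mass psi E (sphere 2 r) <= sqrt3 * q * e * sqrt_e.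
Proof.
move=> r0; rewrite -(@ler_pXn2r _ 2) ?nnegrE ?fourier_mass_ge0 //; last first.
  by rewrite !mulr_ge0 ?sqrtr_ge0.
have -> : (sqrt3 * q * e * sqrt_e) ^+ 2 = 3 * q ^+ 2 * e ^+ 3.
  by rewrite !exprMn sqr_sqrt_e sqr_sqrtr //; ring.
exact: fourier_mass_circle_sqr_le.
Qed.

Let half_q_gt0 : 0 < q / 2. Proof. by rewrite divr_gt0. Qed.

Lemma card_plane_dist_set : 16 * q ^+ 2 <= e * f ->
  1 / 72 * Num.min (q / 2) (sqrt_e * f / (sqrt3 * q)) <= D.
Proof.
move=> ef_ge; have ef_gt0 : 0 < e * f.
  by apply: lt_le_trans ef_ge; rewrite mulr_gt0 ?exprn_gt0.
have [e_gt0 f_gt0] := natr_mul_gt0 ef_gt0.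
have sqrt_e_gt0 : 0 < sqrt_e by rewrite sqrtr_gt0.
have := card_dist_set_ge_mass psiP oddK ef_ge isT fourier_mass_circle_le.
rewrite -/q -/e -/f -/D.
have -> : 17 / 8 / q + sqrt3 * q * e * sqrt_e / (e ^+ 2 * f) =
    17 / 16 / (q / 2) + 1 / (sqrt_e * f / (sqrt3 * q)).
  by rewrite -sqr_sqrt_e; field; rewrite !gt_eqF.
have D9_ge0 : 0 <= 9 * D by rewrite mulr_ge0.
have b_gt0 : 0 < sqrt_e * f / (sqrt3 * q) by rewrite divr_gt0 ?mulr_gt0.
have c_ge0 : 0 <= 17 / 16 :> R by lra.
by move/(min_le_of_inv_sum D9_ge0 c_ge0 ler01 half_q_gt0 b_gt0); have := D_ge0; lra.
Qed.

Section Anisotropic.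
Hypotheses (e_gt0 : 0 < e) (f_gt0 : 0 < f).
Hypothesis nonsquare : forall x : K, x ^+ 2 != -1.
Let sqrt_e_gt0 : 0 < sqrt_e. Proof. by rewrite sqrtr_gt0. Qed.

Lemma sphere_corr0 : sphere_corr psi E G 0 = (#|E| * #|G|)%:R.
Proof.
rewrite /sphere_corr (big_pred1 0) => [|m]; last by rewrite inE sqnorm2_eq0.
by rewrite !(fourier0 psiP) rmorph_nat natrM.
Qed.

Lemma sum_sphere_corr_anisotropic_le :
  (\sum_r normc (sphere_corr psi E G r) ^+ 2) / q ^+ 2 <=
    (sqrt3 + 1) * q * (e * sqrt_e * f).
Proof.
have le_q2 (F : {set 'rV[K]_2}) : #|F|%:R <= q ^+ 2.
  by rewrite -natrX ler_nat (leq_trans (max_card _)) // card_mx mul1n.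
have sqrt_e_le : sqrt_e <= q.
  by rewrite -[q]ger0_norm ?(ltW q_gt0) // -sqrtr_sqr ler_wsqrtr ?le_q2.
have mass_ge0 : 0 <= sqrt3 * q * e * sqrt_e by rewrite !mulr_ge0 ?sqrtr_ge0.
rewrite ler_pdivrMr ?exprn_gt0 // (bigD1 0) //= sphere_corr0 normc_nat natrM -/e -/f.
have := sum_sphere_corr_sqr_le psiP G mass_ge0 fourier_mass_circle_le; rewrite -/q -/f.
have : (e * f) ^+ 2 <= q * (e * sqrt_e * f) * q ^+ 2.
  have -> : (e * f) ^+ 2 = sqrt_e * f * (e * sqrt_e * f) by rewrite -sqr_sqrt_e; ring.
  have -> : q * (e * sqrt_e * f) * q ^+ 2 = q * q ^+ 2 * (e * sqrt_e * f) by ring.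
  apply: ler_wpM2r; first by rewrite !mulr_ge0 ?sqrtr_ge0.
  by apply: ler_pM; rewrite ?sqrtr_ge0 ?le_q2.
by lra.
Qed.

Lemma card_plane_dist_set_anisotropic :
  Num.min (q / 2) (sqrt_e * f / (2 * (sqrt3 + 1) * q)) <= D.
Proof.
have ef_gt0 : 0 < e * f by rewrite mulr_gt0.
have moment := le_trans (sum_dist_count_sqr_corr_le psiP oddK E G)
  (lerD (lexx _) sum_sphere_corr_anisotropic_le).
have := card_dist_set_ge_moment ef_gt0 moment; rewrite -/q -/e -/f -/D.
have sqrt3D1_gt0 : 0 < sqrt3 + 1 by rewrite addr_gt0.
have -> : ((e * f) ^+ 2 / q + (sqrt3 + 1) * q * (e * sqrt_e * f)) / (e * f) ^+ 2 =
    2^-1 / (q / 2) + 2^-1 / (sqrt_e * f / (2 * (sqrt3 + 1) * q)).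
  by rewrite -sqr_sqrt_e; field; rewrite !gt_eqF.
have b_gt0 : 0 < sqrt_e * f / (2 * (sqrt3 + 1) * q) by rewrite divr_gt0 ?mulr_gt0.
have half_ge0 : 0 <= 2^-1 :> R by rewrite invr_ge0.
move/(min_le_of_inv_sum D_ge0 half_ge0 half_ge0 half_q_gt0 b_gt0)/le_trans; apply.
by lra.
Qed.

End Anisotropic.

End PlaneDistanceSets.

Theorem mainTheorem2 (K : finFieldType) (R : rcfType) (d : nat)
    (E G : {set 'rV[K]_d}) :
  odd #|K| ->
  let q : R := (#|K|)%:R in
  let e : R := (#|E|)%:R in
  let f : R := (#|G|)%:R in
  let D : R := (#|dist_set E G|)%:R in
  [/\
   (* (1) *)
   (~~ odd d -> (2 <= d)%N -> (16 * #|K| ^ d <= #|E| * #|G|)%N ->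
     [/\ ((1 <= #|E|)%N -> e < Num.sqrt (q ^+ (d - 1)) -> q / 144 <= D),
         (Num.sqrt (q ^+ (d - 1)) <= e -> e < Num.sqrt (q ^+ (d + 1)) ->
            1 / 144 * Num.min q (f / (2 * Num.sqrt (q ^+ (d - 1)))) <= D)
       & (Num.sqrt (q ^+ (d + 1)) <= e -> e <= q ^+ d ->
            1 / 144 * Num.min q (2 * e * f / q ^+ d) <= D)]),
   (* (2) *)
   (d = 2%N -> (16 * #|K| ^ 2 <= #|E| * #|G|)%N ->
     1 / 72 * Num.min (q / 2) (Num.sqrt e * f / (Num.sqrt 3 * q)) <= D)
  & (* (3) *)
   (d = 2%N -> E != set0 -> G != set0 -> (forall x : K, x ^+ 2 != -1) ->
     Num.min (q / 2) (Num.sqrt e * f / (2 * (Num.sqrt 3 + 1) * q)) <= D)].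
Proof.
move=> oddK q e f D.
have [psi psiP] := exists_nontrivial_char K (pchar_num R[i]).
have natr_ge k : (16 * #|K| ^ k <= #|E| * #|G|)%N -> 16 * q ^+ k <= e * f.
  by rewrite -(ler_nat R) !natrM natrX.
split=> [d_even d_ge2 /natr_ge ef_ge|d2 /natr_ge ef_ge|d2].
- split=> [_ lt_ew|le_we _|_ _].
  + exact: (card_dist_set_small psiP) (ltnW d_ge2) lt_ew.
  + exact: (card_dist_set_medium psiP) (ltnW d_ge2) le_we.
  + exact: (card_dist_set_large psiP).
- subst d; exact: (card_plane_dist_set psiP).
- rewrite -!card_gt0 -!(ltr0n R) => E_gt0 G_gt0 nonsquare; subst d.
  exact: (card_plane_dist_set_anisotropic psiP).
Qed.
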